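(* Suppose that (c1) there is $L\ge0$ such that $|b(x)-b(y)|\le L|x-y|$ for all $x,y\in\mathbb R^d$; (c2) there are $K>0$ and $\mathcal R\ge0$ such that $\langle x-y,b(x)-b(y)\rangle\le-K|x-y|^2$ for all $x,y\in\mathbb R^d$ with $|x-y|\ge\mathcal R$; (c4) $\mu$ has a density $m$ with respect to Lebesgue measure with $m(x)=m(|x|)$, where $r\mapsto m(r)$ is non-increasing on $(0,\infty)$, and $\int_{\mathbb R^d}|z|m(|z|)\,dz<\infty$; and that $\lim_{h\to0^+}h/g(h)=0$. Then there exists a constant $\kappa_0>0$ with $J_{\kappa_0}>0$ such that for any $h\in(0,\,2KL^{-2}\wedge L^{-1})$ with $h/g(h)\le\kappa_0(2L\mathcal R)^{-1}$ there is a constant $c_*\in(0,1)$, independent of $x,y$, such that for all $x,y\in\mathbb R^d$, $$\mathbb E_{x,y}[\rho(X,Y^{(1)})]\le(1-c_* )\rho(x,y),$$ where $((X,Y^{(1)}),\mathbb P_{x,y})$ is the coupling described in the context with parameter $\kappa=g(h)\kappa_0$, $$\rho(x,y)=a\mathbf 1_{\{|x-y|>0\}}+1-e^{-c|x-y|}+ce^{-c\mathcal R}|x-y|,$$ $$c=\frac{32hL\mathcal R}{g(h)^2\kappa_0^2J_{\kappa_0}}+1,\qquad a=\frac{2c(1+e^{-c\mathcal R})h\,g(h)\kappa_0L}{J_{\kappa_0}}+1.$$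
   Context: Setting: $b:\mathbb R^d\to\mathbb R^d$; $g$ is a continuous strictly increasing function on $[0,\infty)$ with $g(0)=0$; $\mu$ is a probability measure on $\mathbb R^d$. For $h>0$, consider the Markov chain on $\mathbb R^d$ with transitions $x\mapsto x+hb(x)+g(h)\xi$, where $\xi\sim\mu$. Write $\hat x=x+hb(x)$. For measures, $\mu\wedge\nu$ denotes the minimum (largest measure dominated by both). For $x\in\mathbb R^d$ and $\kappa>0$ put $(x)_\kappa=\big(1\wedge\frac{\kappa}{|x|}\big)x$ (with $(0)_\kappa=0$), $\mu_x=\mu\wedge(\delta_x*\mu)$, and for $s>0$, $J_s=\inf_{|z|\le s}\big(\mu\wedge(\delta_z*\mu)\big)(\mathbb R^d)$. If $\mathcal R=0$, $\kappa_0(2L\mathcal R)^{-1}$ is read as $+\infty$. (Conditions (c1), (c2) force $0<K\le L$.) Reflection: $R_{x,y}(z)=z-\frac{2\langle x-y,z\rangle}{|x-y|^2}(x-y)$ if $x\ne y$, and $R_{x,x}(z)=z$. Coupling with parameter $\kappa>0$: for $x,y\in\mathbb R^d$ let $v=g(h)^{-1}(\hat x-\hat y)_\kappa$. Under $\mathbb P_{x,y}$, $X=\hat x+g(h)z$ with $z$ distributed as $\mu$, and $\mu$ is split into two parts according to which - $Y^{(1)}=\hat y+g(h)(z+v)$ on the part $\mu_{-v}(dz)$, - $Y^{(1)}=\hat y+g(h)R_{\hat x,\hat y}(z)$ on the part $\mu(dz)-\mu_{-v}(dz)$. That is, for bounded measurable $F$, $\mathbb E_{x,y}[F(X,Y^{(1)})]$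 is the sum of the integrals of $F(\hat x+g(h)z,\,Y^{(1)}(z))$ against the two measures with the corresponding $Y^{(1)}(z)$. *)

(* Defs.v *)
From HB Require Import structures.
From mathcomp Require Import all_boot all_order all_algebra.
From mathcomp Require Import all_classical all_reals all_analysis.
From mathcomp Require Import measurable_realfun.

Set Implicit Arguments.
Unset Strict Implicit.
Unset Printing Implicit Defensive.

Import Order.TTheory GRing.Theory Num.Theory.
Import numFieldNormedType.Exports.

Local Open Scope classical_set_scope.
Local Open Scope ring_scope.

(* [pushforward m f], with the measurability of f recorded so that it is
   canonically a measure. *)
Definition image_measure d1 d2 (T1 : measurableType d1)
    (T2 : measurableType d2) (R : realType) (f : T1 -> T2)
    (mf : measurable_fun setT f) (m : set T1 -> \bar R) : set T2 -> \bar R :=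
  pushforward m f.

Section image_measure.
Context d1 d2 (T1 : measurableType d1) (T2 : measurableType d2)
  (R : realType).
Variables (f : T1 -> T2) (mf : measurable_fun setT f).

Section measure.
Variable m : {measure set T1 -> \bar R}.
Let nu := image_measure mf m.

Let nu0 : nu set0 = 0%E.
Proof. by rewrite /nu /image_measure /pushforward preimage_set0 measure0. Qed.

Let nu_ge0 A : (0 <= nu A)%E. Proof. exact: measure_ge0. Qed.

Let nu_sigma_additive : semi_sigma_additive nu.
Proof.
move=> F mF tF mUF; rewrite /nu /image_measure /pushforward preimage_bigcup.
have mfF k : measurable (f @^-1` F k).
  by rewrite -[X in measurable X]setTI; exact: mf.
apply: measure_semi_sigma_additive => //; last exact: bigcupT_measurable.
apply/trivIsetP => /= i j _ _ ij; rewrite -preimage_setI.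
by move/trivIsetP : tF => /(_ _ _ _ _ ij) ->//; rewrite preimage_set0.
Qed.

HB.instance Definition _ := isMeasure.Build _ _ _ (image_measure mf m)
  nu0 nu_ge0 nu_sigma_additive.

End measure.

Section finite.
Variable m : {finite_measure set T1 -> \bar R}.

Let nu_fin : fin_num_fun (image_measure mf m).
Proof.
move=> A mA; apply: fin_num_measure.
by rewrite -[X in measurable X]setTI; exact: mf.
Qed.

HB.instance Definition _ :=
  Measure_isFinite.Build _ _ _ (image_measure mf m) nu_fin.

End finite.

End image_measure.

(* The norm that the libraries put on 'rV[R]_n is the sup norm; [enorm] is the
   Euclidean one. *)
Definition dotp {R : realType} {n : nat} (x y : 'rV[R]_n) : R :=
  \sum_(i < n) x 0 i * y 0 i.

Definition enorm {R : realType} {n : nat} (x : 'rV[R]_n) : R :=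
  Num.sqrt (dotp x x).

(* 'rV[R]_n carries the product sigma-algebra, generated by the coordinates;
   this is the Borel sigma-algebra (see [open_measurable_rV]). *)
Section measurable_rV.
Context {R : realType} {n : nat}.

Let coord (i : 'I_n) (x : 'rV[R]_n) : R := x 0 i.

HB.instance Definition _ := @isMeasurable.Build default_measure_display
  'rV[R]_n (g_sigma_preimage coord) (@sigma_algebra0 _ setT _)
  (fun A => @sigma_algebraC _ _ A) (@sigma_algebra_bigcup _ setT _).

Lemma measurable_coord (i : 'I_n) :
  measurable_fun setT (fun x : 'rV[R]_n => x 0 i).
Proof.
move=> _ Y mY; rewrite setTI; apply: sub_sigma_algebra => /=.
rewrite -bigcup_seq/=; exists i => /=; first by rewrite mem_index_enum.
by exists Y => //; rewrite setTI.
Qed.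

Lemma measurable_fun_rVP d (T : measurableType d) (f : T -> 'rV[R]_n) :
  (forall i, measurable_fun setT (fun t => f t 0 i)) -> measurable_fun setT f.
Proof.
move=> mf _ A mA.
pose G := [set B : set 'rV[R]_n | measurable (f @^-1` B)].
suff : g_sigma_preimage coord `<=` G by move=> /(_ A mA); rewrite setTI.
apply: smallest_sub; last first.
  move=> B; rewrite -bigcup_seq/= => -[i _ [C mC <-]].
  by rewrite /G/= setTI -[X in measurable X]setTI; exact: (mf i).
split => [|B|F mF]; rewrite /G/=.
- by rewrite preimage_set0.
- by move=> mB; rewrite setTD preimage_setC; exact: measurableC.
- by rewrite preimage_bigcup; exact: bigcupT_measurable.
Qed.

End measurable_rV.

Lemma open_measurable_rV {R : realType} {n : nat} (U : set 'rV[R]_n) :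
  open U -> measurable U.
Proof.
move=> oU.
pose box (p : 'rV[rat]_n * nat) : set 'rV[R]_n :=
  \bigcap_(i : 'I_n) ((fun x : 'rV[R]_n => x 0 i) @^-1`
    ball (ratr (p.1 0 i) : R) p.2.+1%:R^-1).
have mbox p : measurable (box p).
  apply: fin_bigcap_measurable; first exact: finite_finset.
  move=> i _; rewrite -[X in measurable X]setTI; apply: measurable_coord => //.
  exact: measurable_ball.
rewrite (_ : U = \bigcup_(p in [set p | box p `<=` U]) box p).
  rewrite bigcup_mkcond; apply: countable_bigcupT_measurable => //.
  by move=> p; case: ifPn.
apply/seteqP; split => [x Ux|x [p pU /pU //]].
have /nbhs_ballP[e /= e0 eU] : nbhs x U by exact: open_nbhs_nbhs.
have [k] : exists k : nat, 0 + k.+1%:R^-1 < e / 2.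
  by apply: ltr_add_invr; rewrite divr_gt0.
rewrite add0r => ke.
have k0 : 0 < k.+1%:R^-1 :> R by rewrite invr_gt0.
have xq (i : 'I_n) : exists q : rat, ball (ratr q : R) k.+1%:R^-1 (x 0 i).
  have [|q] := @rat_in_itvoo R (x 0 i - k.+1%:R^-1) (x 0 i + k.+1%:R^-1).
    by rewrite ltrD2l gtrN.
  by rewrite in_itv/= => qx; exists q; rewrite /ball/= distrC ltr_distlC.
have [q qx] : exists q : 'rV[rat]_n,
    forall i, ball (ratr (q 0 i) : R) k.+1%:R^-1 (x 0 i).
  have [f fx] := choice xq.
  by exists (\row_i f i) => i; rewrite mxE.
exists (q, k); last by move=> i _; exact: qx.
move=> y qy; apply: eU; split => // i j; rewrite ord1.
apply: (@le_ball _ _ _ (k.+1%:R^-1 + k.+1%:R^-1)).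
  by rewrite (splitr e) lerD// ltW.
by apply: ball_triangle (qy j Logic.I); apply: ball_sym; exact: qx.
Qed.

Section lebesgue_rV.
Context {R : realType}.

Definition cons_row (n : nat) (p : R * 'rV[R]_n) : 'rV[R]_n.+1 :=
  \row_i (if unlift ord0 i is Some j then p.2 0 j else p.1).

Let behead_row (n : nat) (x : 'rV[R]_n.+1) : R * 'rV[R]_n :=
  (x 0 ord0, \row_i x 0 (lift ord0 i)).

Let behead_rowK n : cancel (@behead_row n) (@cons_row n).
Proof.
move=> x; apply/rowP => i; rewrite mxE; case: unliftP => [j|] -> //=.
by rewrite mxE.
Qed.

Let cons_rowK n : cancel (@cons_row n) (@behead_row n).
Proof.
move=> [r x]; rewrite /behead_row mxE unlift_none; congr (_, _).
by apply/rowP => i; rewrite !mxE liftK.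
Qed.

Lemma measurable_cons_row n : measurable_fun setT (@cons_row n).
Proof.
apply: measurable_fun_rVP => i; case: (unliftP ord0 i) => [j|] ->.
  apply: (eq_measurable_fun (fun p : R * 'rV[R]_n => p.2 0 j)).
    by move=> p _; rewrite mxE liftK.
  by apply: (measurableT_comp (measurable_coord j)); exact: measurable_snd.
apply: (eq_measurable_fun fst); last exact: measurable_fst.
by move=> p _; rewrite mxE unlift_none.
Qed.

Let measurable_behead_row n : measurable_fun setT (@behead_row n).
Proof.
apply/measurable_fun_pairP; split; first exact: measurable_coord.
apply: measurable_fun_rVP => i.
apply: (eq_measurable_fun (fun x : 'rV[R]_n.+1 => x 0 (lift ord0 i))).
  by move=> x _; rewrite mxE.
exact: measurable_coord.
Qed.

Section product_step.
Variables (n : nat) (m : {sigma_finite_measure set 'rV[R]_n -> \bar R}).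

Definition lebesgue_cons : set 'rV[R]_n.+1 -> \bar R :=
  @image_measure _ _ (measurableTypeR R * 'rV[R]_n)%type _ R (@cons_row n)
    (@measurable_cons_row n) (lebesgue_measure \x m)%E.

HB.instance Definition _ := Measure.on lebesgue_cons.

Let lebesgue_cons_sigma_finite : sigma_finite setT lebesgue_cons.
Proof.
have /sigma_finiteP[F [TF ndF Foo]] := sigma_finiteT (@lebesgue_measure R).
have /sigma_finiteP[G [TG ndG Goo]] := sigma_finiteT m.
exists (fun k => @behead_row n @^-1` (F k `*` G k)).
  rewrite -preimage_bigcup -(preimage_setT (@behead_row n)); congr (_ @^-1` _).
  apply/seteqP; split => // -[r x] _.
  have [i _ Fr] : (\bigcup_i F i) r by rewrite -TF.
  have [j _ Gx] : (\bigcup_i G i) x by rewrite -TG.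
  exists (maxn i j) => //; split => /=.
    by move: Fr; exact/subsetPset/ndF/leq_maxl.
  by move: Gx; exact/subsetPset/ndG/leq_maxr.
move=> k; have [mF Fk] := Foo k; have [mG Gk] := Goo k; split.
  rewrite -[X in measurable X]setTI; apply: measurable_behead_row => //.
  exact: measurableX.
rewrite /lebesgue_cons /image_measure /pushforward -comp_preimage.
rewrite (_ : _ \o _ = id); last by apply/funext => p /=; rewrite cons_rowK.
by rewrite preimage_id product_measure1E// lte_mul_pinfty// ge0_fin_numE.
Qed.

HB.instance Definition _ := Measure_isSigmaFinite.Build _ _ _ lebesgue_cons
  lebesgue_cons_sigma_finite.

End product_step.

(* n-dimensional Lebesgue measure, as the n-fold product of the library's
   one-dimensional [lebesgue_measure]; 'rV_0 is a single point. *)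
Fixpoint lebesgue_rV (n : nat) :
    {sigma_finite_measure set 'rV[R]_n -> \bar R} :=
  match n with
  | 0%N => \d_(0 : 'rV[R]_0)
  | n'.+1 => lebesgue_cons (lebesgue_rV n')
  end.

Lemma lebesgue_rV_box n (A : 'I_n -> set R) : (forall i, measurable (A i)) ->
  lebesgue_rV n [set x : 'rV[R]_n | forall i, A i (x 0 i)] =
    (\prod_(i < n) lebesgue_measure (A i))%E.
Proof.
elim: n A => [|n IHn] A mA.
  rewrite big_ord0 (_ : [set _ | _] = setT); first exact: diracT.
  by apply/seteqP; split => // x _ [].
rewrite big_ord_recl -IHn//= /lebesgue_cons /image_measure /pushforward.
rewrite -product_measure1E//.
  congr ((_ \x _)%E _); apply/seteqP; split => [[r x]/= Ax|[r x]/= [Ar Ax] i].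
    split => [|i]; first by have := Ax ord0; rewrite mxE unlift_none.
    by have := Ax (lift ord0 i); rewrite mxE liftK.
  by rewrite mxE; case: unliftP => [j|] ->.
  exact: mA.
rewrite (_ : mkset _ =
    \bigcap_(i : 'I_n) ((fun x : 'rV[R]_n => x 0 i) @^-1` A (lift ord0 i))).
  apply: fin_bigcap_measurable; first exact: finite_finset.
  by move=> i _; rewrite -[X in measurable X]setTI; exact: measurable_coord.
by apply/seteqP; split => [x Ax i _|x Ax i]; [exact: Ax|exact: (Ax i)].
Qed.

End lebesgue_rV.
Arguments lebesgue_rV {R} n.

Definition measure_le d (T : measurableType d) (R : realType)
    (mu1 mu2 : set T -> \bar R) : Prop :=
  forall A, measurable A -> (mu1 A <= mu2 A)%E.

Section measure_sub.
Context d (T : measurableType d) (R : realType).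
Variables (mu nu : {finite_measure set T -> \bar R}) (numu : measure_le nu mu).

(* mu - nu; the maximum only matters on non-measurable sets, where nothing is
   known about mu and nu. *)
Definition measure_sub (_ : measure_le nu mu) (A : set T) : \bar R :=
  Order.max 0%E (mu A - nu A)%E.

Lemma measure_subE A : measurable A -> measure_sub numu A = (mu A - nu A)%E.
Proof.
by move=> mA; apply/max_idPr; rewrite sube_ge0 ?numu// fin_num_measure.
Qed.

Let measure_sub0 : measure_sub numu set0 = 0%E.
Proof. by rewrite measure_subE// !measure0 sube0. Qed.

Let measure_sub_ge0 A : (0 <= measure_sub numu A)%E.
Proof. by rewrite /measure_sub le_max lexx. Qed.

Let measure_sub_sigma_additive : semi_sigma_additive (measure_sub numu).
Proof.
pose diff : {charge set T -> \bar R} := cadd (charge_of_finite_measure mu)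
  (cscale (-1) (charge_of_finite_measure nu)).
have diffE A : measurable A -> measure_sub numu A = diff A.
  by move=> mA; rewrite measure_subE// -mulN1e.
move=> F mF tF mUF; rewrite diffE//.
rewrite (_ : (fun k => _) = fun k => (\sum_(0 <= i < k) diff (F i))%E).
  exact: (charge_semi_sigma_additive F).
by apply/funext => k; apply: eq_bigr => i _; exact: diffE.
Qed.

HB.instance Definition _ := isMeasure.Build _ _ _ (measure_sub numu)
  measure_sub0 measure_sub_ge0 measure_sub_sigma_additive.

Let measure_sub_fin : fin_num_fun (measure_sub numu).
Proof.
by move=> A mA; rewrite measure_subE// fin_numB !fin_num_measure.
Qed.

HB.instance Definition _ :=
  Measure_isFinite.Build _ _ _ (measure_sub numu) measure_sub_fin.

End measure_sub.

Section measure_min.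
Context d (T : measurableType d) (R : realType).
Variables mu nu : {finite_measure set T -> \bar R}.

Definition is_measure_min (la : set T -> \bar R) : Prop :=
  [/\ measure_le la mu, measure_le la nu &
      forall la' : {measure set T -> \bar R},
        measure_le la' mu -> measure_le la' nu -> measure_le la' la].

Lemma measure_min_exists :
  exists la : {measure set T -> \bar R}, is_measure_min la.
Proof.
pose diff : {charge set T -> \bar R} := cadd (charge_of_finite_measure nu)
  (cscale (-1) (charge_of_finite_measure mu)).
have diffE A : diff A = (nu A - mu A)%E by rewrite -mulN1e.
have [P [N [[mP posP] [mN negN] PN PN0]]] := Hahn_decomposition diff.
have leP A : measurable A -> (mu (A `&` P) <= nu (A `&` P))%E.
  move=> mA; have mAP := measurableI _ _ mA mP.
  by rewrite -sube_ge0 ?fin_num_measure// -diffE; exact: posP.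
have leN A : measurable A -> (nu (A `&` N) <= mu (A `&` N))%E.
  move=> mA; have mAN := measurableI _ _ mA mN.
  by rewrite -sube_le0 ?fin_num_measure// -diffE; exact: negN.
pose la : {measure set T -> \bar R} := measure_add (mrestr mu mP) (mrestr nu mN).
have laE A : la A = (mu (A `&` P) + nu (A `&` N))%E.
  exact: measure_addE.
have split (m : {measure set T -> \bar R}) A : measurable A ->
    m A = (m (A `&` P) + m (A `&` N))%E.
  move=> mA; rewrite -measureU; [|exact: measurableI|exact: measurableI|].
    by rewrite -setIUr PN setIT.
  by rewrite setIACA PN0 setI0.
exists la; split => [A mA|A mA|la' la'mu la'nu A mA] /=.
- by rewrite laE (split mu A mA) leeD2l// leN.
- by rewrite laE (split nu A mA) leeD2r// leP.
- rewrite laE (split la' A mA) leeD//.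
    by apply: la'mu; exact: measurableI.
  by apply: la'nu; exact: measurableI.
Qed.

(* mu /\ nu, the largest measure dominated by both; it is unique on
   measurable sets. *)
Definition measure_min : set T -> \bar R := sval (cid measure_min_exists).

HB.instance Definition _ := Measure.on measure_min.

Lemma measure_minP : is_measure_min measure_min.
Proof. exact: (svalP (cid measure_min_exists)). Qed.

Lemma measure_min_lel : measure_le measure_min mu.
Proof. by have [] := measure_minP. Qed.

Let measure_min_fin : fin_num_fun measure_min.
Proof.
move=> A mA; rewrite ge0_fin_numE//.
by rewrite (le_lt_trans (measure_min_lel mA))// ltey_eq fin_num_measure.
Qed.

HB.instance Definition _ :=
  Measure_isFinite.Build _ _ _ measure_min measure_min_fin.

End measure_min.

Section convolution.
Context {R : realType} {n : nat}.
Implicit Types (x y z v : 'rV[R]_n) (mu nu : probability 'rV[R]_n R).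

Lemma measurable_add_rV :
  measurable_fun setT (fun p : 'rV[R]_n * 'rV[R]_n => p.1 + p.2).
Proof.
apply: measurable_fun_rVP => i.
apply: (eq_measurable_fun
    (fun p : 'rV[R]_n * 'rV[R]_n => p.1 0 i + p.2 0 i)).
  by move=> p _; rewrite mxE.
apply: measurable_funD.
  by apply: (measurableT_comp (measurable_coord i)); exact: measurable_fst.
by apply: (measurableT_comp (measurable_coord i)); exact: measurable_snd.
Qed.

Definition convolution mu nu : set 'rV[R]_n -> \bar R :=
  image_measure measurable_add_rV (mu \x nu)%E.

Section convolution_probability.
Variables mu nu : probability 'rV[R]_n R.

HB.instance Definition _ := Measure.on (convolution mu nu).

Let convolution_setT : convolution mu nu setT = 1%E.
Proof.
rewrite /convolution /image_measure /pushforward preimage_setT.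
rewrite -setXTT; transitivity (mu setT * nu setT)%E.
  exact: product_measure1E.
by rewrite !probability_setT mule1.
Qed.

HB.instance Definition _ :=
  Measure_isProbability.Build _ _ _ (convolution mu nu) convolution_setT.

End convolution_probability.

Lemma convolution_diracE x mu A : measurable A ->
  convolution \d_x mu A = mu [set z | A (x + z)].
Proof.
move=> mA; rewrite /convolution /image_measure /pushforward /product_measure1.
rewrite integral_dirac//; last first.
  apply: measurable_fun_xsection.
  by rewrite -[X in measurable X]setTI; exact: measurable_add_rV.
rewrite diracT mul1e /=; congr (mu _); apply/seteqP; split => z /=.
  by rewrite /xsection/= inE.
by rewrite /xsection/= inE.
Qed.

Definition overlap mu x : {finite_measure set 'rV[R]_n -> \bar R} :=
  measure_min mu (convolution \d_x mu).

(* The infimum J_s; it lies in [0, 1], so [fine] loses nothing. *)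
Definition overlap_inf mu (s : R) : R :=
  fine (ereal_inf [set overlap mu z setT | z in [set z | enorm z <= s]]).

(* (x)_kappa; at x = 0 it is 0, whatever the scalar factor. *)
Definition truncate (kappa : R) x : 'rV[R]_n :=
  Num.min 1 (kappa / enorm x) *: x.

Definition reflection x y z : 'rV[R]_n :=
  if x == y then z
  else z - (2 * dotp (x - y) z / enorm (x - y) ^+ 2) *: (x - y).

Lemma overlap_le mu x : measure_le (overlap mu x) mu.
Proof. exact: measure_min_lel. Qed.

End convolution.

Section coupling.
Context {R : realType} {n : nat}.
Variables (b : 'rV[R]_n -> 'rV[R]_n) (g : R -> R) (h kappa : R).
Variables (mu : probability 'rV[R]_n R) (x y : 'rV[R]_n).

Definition drift_step (u : 'rV[R]_n) : 'rV[R]_n := u + h *: b u.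

Let xh := drift_step x.
Let yh := drift_step y.

Definition coupling_shift : 'rV[R]_n := (g h)^-1 *: truncate kappa (xh - yh).

Let v := coupling_shift.

Definition coupling_sync (z : 'rV[R]_n) : 'rV[R]_n * 'rV[R]_n :=
  (xh + g h *: z, yh + g h *: (z + v)).

Definition coupling_refl (z : 'rV[R]_n) : 'rV[R]_n * 'rV[R]_n :=
  (xh + g h *: z, yh + g h *: reflection xh yh z).

Let measurable_affine (u : 'rV[R]_n) (r : R)
    (f : 'rV[R]_n -> 'rV[R]_n) : measurable_fun setT f ->
  measurable_fun setT (fun z => u + r *: f z).
Proof.
move=> mf; apply: measurable_fun_rVP => i.
apply: (eq_measurable_fun (fun z => u 0 i + r * f z 0 i)).
  by move=> z _; rewrite !mxE.
apply: measurable_funD => //; apply: measurable_funM => //.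
exact: (measurableT_comp (measurable_coord i)).
Qed.

Let measurable_dotp (w : 'rV[R]_n) : measurable_fun setT (dotp w).
Proof.
apply: measurable_sum => i; apply: measurable_funM => //.
exact: measurable_coord.
Qed.

Lemma measurable_coupling_sync : measurable_fun setT coupling_sync.
Proof.
apply/measurable_fun_pairP; split; apply: measurable_affine => //.
apply: measurable_fun_rVP => i.
apply: (eq_measurable_fun (fun z : 'rV[R]_n => z 0 i + v 0 i)).
  by move=> z _; rewrite [RHS]mxE.
by apply: measurable_funD => //; exact: measurable_coord.
Qed.

Lemma measurable_coupling_refl : measurable_fun setT coupling_refl.
Proof.
apply/measurable_fun_pairP; split; apply: measurable_affine => //.
rewrite /reflection; case: eqP => // _; apply: measurable_fun_rVP => i.
apply: (eq_measurable_fun (fun z : 'rV[R]_n => z 0 i -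
    2 * dotp (xh - yh) z / enorm (xh - yh) ^+ 2 * (xh - yh) 0 i)).
  by move=> z _; rewrite !mxE.
apply: measurable_funB; first exact: measurable_coord.
apply: measurable_funM => //; apply: measurable_funM => //.
exact: measurable_funM.
Qed.

(* The law of (X, Y^(1)) under P_{x,y}. *)
Definition coupling : set ('rV[R]_n * 'rV[R]_n) -> \bar R :=
  measure_add (image_measure measurable_coupling_sync (overlap mu (- v)))
    (image_measure measurable_coupling_refl
      (measure_sub (overlap_le mu (- v)))).

HB.instance Definition _ := Measure.on coupling.

Let coupling_setT : coupling setT = 1%E.
Proof.
rewrite /coupling measure_addE /= /image_measure /pushforward !preimage_setT.
rewrite measure_subE// addeC subeK; first exact: probability_setT.
exact: fin_num_measure.
Qed.

HB.instance Definition _ :=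
  Measure_isProbability.Build _ _ _ coupling coupling_setT.

Lemma ge0_integral_coupling (F : 'rV[R]_n * 'rV[R]_n -> \bar R) :
  measurable_fun setT F -> (forall p, (0 <= F p)%E) ->
  (\int[coupling]_p F p =
     \int[overlap mu (- v)]_z F (coupling_sync z) +
     \int[measure_sub (overlap_le mu (- v))]_z F (coupling_refl z))%E.
Proof.
move=> mF F0; rewrite /coupling ge0_integral_measure_add//; congr (_ + _)%E.
  by rewrite ge0_integral_pushforward//; exact: measurable_coupling_sync.
by rewrite ge0_integral_pushforward//; exact: measurable_coupling_refl.
Qed.

End coupling.

Definition rho {R : realType} {n : nat} (a c Rr : R) (x y : 'rV[R]_n) : R :=
  let r := enorm (x - y) in
  a * (0 < r)%R%:R + 1 - expR (- (c * r)) + c * expR (- (c * Rr)) * r.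

(* Main.v *)
Require Import Defs.
From HB Require Import structures.
From mathcomp Require Import all_boot all_order all_algebra.
From mathcomp Require Import all_classical all_reals all_analysis.
From mathcomp Require Import measurable_realfun ring lra.

Set Implicit Arguments.
Unset Strict Implicit.
Unset Printing Implicit Defensive.

Import Order.TTheory GRing.Theory Num.Theory.
Import numFieldNormedType.Exports.

Local Open Scope classical_set_scope.
Local Open Scope ring_scope.

(** Let x and y be distinct, r = |x - y|, u the difference of the two drifted
points, rh = |u|, kappa = g(h) kappa0, s = min(rh, kappa), so that the shift v
of the coupling is a positive multiple of u with g(h) |v| = s.  Write
rho = a 1_{r > 0} + psi(r) with psi(r) = 1 - exp(-c r) + c exp(-c Rr) r, the
concave increasing [profile], and let p >= J be the mass of the overlap of mu
with its translate.

On the overlap the new distance is exactly rh - s.  The remaining mass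
mu - mu_{-v} lives on the half-space of the points nearer to 0 than to -v,
because the density is radial and non-increasing ([overlapE]); there the
reflected points are at distance rh + 2 g(h) <u, z> / rh, which is at least
rh - s ([dist_coupling_refl]).  The coupling preserves the mean distance: the
linear part of the reflected distance integrates to exactly what the
synchronous part lost.  This is [residual_moment], and it rests on the
invariance of Lebesgue measure under point symmetries, in particular under the
one exchanging 0 and -v.
Bounding psi by its tangent at rh on the reflected part then gives
([expectation_coupling_le])

  E rho <= p (a 1_{s < rh} + psi(rh - s) + s psi'(rh))
           + (1 - p) (a + psi(rh)).

What is left is one-variable calculus ([contraction_rate]), in three regimes.
If rh <= kappa, the points meet with probability at least J, and a is large
enough for a J to pay for the growth psi(rh) - psi(r) caused by the drift.  If
rh > kappa and r < Rr, the strict concavity of psi yields a gain of order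
J (c kappa)^2 exp(-c r), and c is chosen so that this gain exceeds the drift term
2 c exp(-c r) h L Rr.  If rh > kappa and r >= Rr, dissipativity makes rh
at most lam r with lam < 1, and the linear part of psi gains a fixed
proportion of r, while a is absorbed because r > kappa.

The constant kappa0 comes from a radius r0 inside which the density is bounded
below: for |v| <= r0 / 2 the half-space farther from 0 than from -v contains a
cube of fixed size within that radius ([overlap_lower_bound]). *)

(** * Euclidean geometry of row vectors *)

Section euclidean.
Context {R : realType} {n : nat}.
Implicit Types (x y z : 'rV[R]_n) (k : R).

Lemma dotpC x y : dotp x y = dotp y x.
Proof. by apply: eq_bigr => i _; rewrite mulrC. Qed.

Lemma dotpDl x y z : dotp (x + y) z = dotp x z + dotp y z.
Proof. by rewrite -big_split; apply: eq_bigr => i _; rewrite !mxE mulrDl. Qed.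

Lemma dotpZl k x y : dotp (k *: x) y = k * dotp x y.
Proof. by rewrite mulr_sumr; apply: eq_bigr => i _; rewrite !mxE mulrA. Qed.

Lemma dotpDr x y z : dotp x (y + z) = dotp x y + dotp x z.
Proof. by rewrite dotpC dotpDl !(dotpC x). Qed.

Lemma dotpZr k x y : dotp x (k *: y) = k * dotp x y.
Proof. by rewrite dotpC dotpZl dotpC. Qed.

Lemma dotpNr x y : dotp x (- y) = - dotp x y.
Proof. by rewrite -scaleN1r dotpZr mulN1r. Qed.

Lemma dotpNl x y : dotp (- x) y = - dotp x y.
Proof. by rewrite dotpC dotpNr dotpC. Qed.

Lemma dotp_ge0 x : 0 <= dotp x x.
Proof. by apply: sumr_ge0 => i _; rewrite -expr2 sqr_ge0. Qed.

Lemma enorm_ge0 x : 0 <= enorm x.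
Proof. exact: sqrtr_ge0. Qed.

Lemma sqr_enorm x : enorm x ^+ 2 = dotp x x.
Proof. by rewrite sqr_sqrtr// dotp_ge0. Qed.

Lemma enormZ k x : enorm (k *: x) = `|k| * enorm x.
Proof.
by rewrite /enorm dotpZl dotpZr mulrA -expr2 sqrtrM ?sqr_ge0// sqrtr_sqr.
Qed.

Lemma enormN x : enorm (- x) = enorm x.
Proof. by rewrite -scaleN1r enormZ normrN1 mul1r. Qed.

Lemma enorm0 : enorm (0 : 'rV[R]_n) = 0.
Proof. by rewrite -(scale0r 0) enormZ normr0 mul0r. Qed.

Lemma enorm_eq0 x : (enorm x == 0) = (x == 0).
Proof.
apply/idP/eqP => [/eqP x0|->]; last by rewrite enorm0.
have := sqr_enorm x; rewrite x0 expr0n/= => /esym/eqP.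
rewrite psumr_eq0 => [/allP x0'|i _]; last by rewrite -expr2 sqr_ge0.
apply/rowP => i; rewrite mxE.
by have := x0' i (mem_index_enum _); rewrite /= mulf_eq0 orbb => /eqP.
Qed.

Lemma enorm_gt0 x : (0 < enorm x) = (x != 0).
Proof. by rewrite lt_neqAle enorm_ge0 andbT eq_sym enorm_eq0. Qed.

Lemma cauchy_schwarz x y : dotp x y <= enorm x * enorm y.
Proof.
have [->|y0] := eqVneq y 0.
  by rewrite enorm0 mulr0 -(scale0r 0) dotpZr mul0r.
have yy : 0 < dotp y y by rewrite -sqr_enorm exprn_gt0// enorm_gt0.
have := dotp_ge0 (dotp y y *: x - dotp x y *: y).
have -> : dotp (dotp y y *: x - dotp x y *: y)
    (dotp y y *: x - dotp x y *: y) =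
    dotp y y * (dotp x x * dotp y y - dotp x y ^+ 2).
  rewrite !(dotpDl, dotpDr, dotpNl, dotpNr, dotpZl, dotpZr) (dotpC y x).
  by ring.
rewrite pmulr_rge0// subr_ge0 -!sqr_enorm -exprMn => xy.
rewrite (le_trans (ler_norm _))// -(@ler_pXn2r _ 2)// ?nnegrE ?normr_ge0//.
  by rewrite real_normK// num_real.
by rewrite mulr_ge0 ?enorm_ge0.
Qed.

Lemma ler_enormD x y : enorm (x + y) <= enorm x + enorm y.
Proof.
rewrite -(@ler_pXn2r _ 2)// ?nnegrE ?addr_ge0 ?enorm_ge0//.
rewrite sqrrD !sqr_enorm dotpDl !dotpDr (dotpC y x).
have := cauchy_schwarz x y; rewrite -mulr_natr; lra.
Qed.

Lemma enorm_le_sum x : enorm x <= \sum_i `|x 0 i|.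
Proof.
have s0 : 0 <= \sum_i `|x 0 i| by apply: sumr_ge0.
rewrite -(@ler_pXn2r _ 2)// ?nnegrE ?enorm_ge0// sqr_enorm expr2 mulr_suml.
apply: ler_sum => i _; rewrite -expr2 -real_normK ?num_real// expr2.
by rewrite ler_wpM2l// (bigD1 i)//= lerDl sumr_ge0.
Qed.

Lemma enorm_add_sqr x v : enorm (x + v) ^+ 2 =
  enorm x ^+ 2 + 2 * dotp v x + enorm v ^+ 2.
Proof. by rewrite !sqr_enorm !(dotpDl, dotpDr) (dotpC x v); ring. Qed.

Lemma measurable_dotp x : measurable_fun setT (dotp x).
Proof.
apply: measurable_sum => i; apply: measurable_funM => //.
exact: measurable_coord.
Qed.

Lemma measurable_enorm : measurable_fun setT (@enorm R n).
Proof.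
apply: measurableT_comp.
  by apply: continuous_measurable_fun; exact: sqrt_continuous.
by apply: measurable_sum => i; apply: measurable_funM => //;
  exact: measurable_coord.
Qed.

End euclidean.

(** * Point symmetries preserve Lebesgue measure *)

Section central_symmetry_invariance.
Context {R : realType}.

(** A reflected half-open interval is half-open on the other side, which does
    not change its length, and half-open intervals determine the measure. *)
Lemma lebesgue_measure_central_symmetry (u : R) (A : set R) : measurable A ->
  lebesgue_measure [set r | A (u - r)] = lebesgue_measure A.
Proof.
move=> mA.
have mf : measurable_fun setT
    (fun r : measurableTypeR R => u - r : measurableTypeR R).
  exact: measurable_funB.
apply/esym.
apply: (@lebesgue_measure_unique _ (image_measure mf lebesgue_measure)) => // X.
move=> [[a b] /= _ <-].
rewrite /image_measure /pushforward lebesgue_measure_itv/=.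
rewrite (_ : _ @^-1` _ = `[u - b, u - a[%classic).
  rewrite lebesgue_measure_itv/= !lte_fin ltrD2l ltrN2.
  by case: ifPn => // _; rewrite -!EFinD; congr EFin; lra.
apply/seteqP; split => r /=; rewrite !in_itv/= => /andP[? ?]; apply/andP; split; lra.
Qed.

Lemma measurable_central_symmetry n (u : 'rV[R]_n) :
  measurable_fun setT (fun z : 'rV[R]_n => u - z).
Proof.
apply: measurable_fun_rVP => i.
apply: (eq_measurable_fun (fun z : 'rV[R]_n => u 0 i - z 0 i)).
  by move=> z _; rewrite !mxE.
by apply: measurable_funB => //; exact: measurable_coord.
Qed.

Lemma measurable_translation n (u : 'rV[R]_n) :
  measurable_fun setT (fun z : 'rV[R]_n => u + z).
Proof.
apply: measurable_fun_rVP => i.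
apply: (eq_measurable_fun (fun z : 'rV[R]_n => u 0 i + z 0 i)).
  by move=> z _; rewrite mxE.
by apply: measurable_funD => //; exact: measurable_coord.
Qed.

(** Point symmetries are the only isometries used below; they act coordinate by
    coordinate, so the uniqueness of product measures gives an induction on the
    dimension. *)
Lemma lebesgue_rV_central_symmetry n (u : 'rV[R]_n) (A : set 'rV[R]_n) :
  measurable A -> lebesgue_rV n [set z | A (u - z)] = lebesgue_rV n A.
Proof.
elim: n u A => [|n IHn] u A mA.
  rewrite (_ : [set z | A (u - z)] = A)//; apply/seteqP.
  have e : forall x y : 'rV[R]_0, x = y by move=> x y; apply/rowP; case.
  by split => z /=; rewrite (e (u - z) z).
pose u1 := u 0 ord0; pose u2 : 'rV[R]_n := \row_i u 0 (lift ord0 i).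
pose s (p : measurableTypeR R * 'rV[R]_n) : measurableTypeR R * 'rV[R]_n :=
  (u1 - p.1, u2 - p.2).
have ms : measurable_fun setT s.
  apply/measurable_fun_pairP; split.
    by apply: measurable_funB => //; exact: measurable_fst.
  apply: (measurableT_comp (measurable_central_symmetry u2)).
  exact: measurable_snd.
pose m' := image_measure ms (lebesgue_measure \x lebesgue_rV n)%E.
have mcA : measurable (@cons_row R n @^-1` A).
  by rewrite -[X in measurable X]setTI; exact: measurable_cons_row.
rewrite /= /lebesgue_cons /image_measure /pushforward.
rewrite [RHS](@product_measure_unique _ _ _ _ _ _ _ m')//.
  rewrite /m' /image_measure /pushforward; congr ((_ \x _)%E _).
  apply/seteqP; split => p /=; congr (A _); apply/rowP => i; rewrite !mxE;
    by case: unliftP => [j ->|->]; rewrite ?mxE.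
move=> B C mB mC; rewrite /m' /image_measure /pushforward.
rewrite -(IHn u2 C mC).
have := lebesgue_measure_central_symmetry u1 mB => /= BE.
rewrite -[X in _ = (X * _)%E]BE.
rewrite -product_measure1E//.
  have mu1 : measurable_fun setT
      (fun r : measurableTypeR R => u1 - r : measurableTypeR R).
    exact: measurable_funB.
  by rewrite -[X in measurable X]setTI; exact: mu1.
by rewrite -[X in measurable X]setTI; exact: measurable_central_symmetry.
Qed.

Lemma lebesgue_rV_set1 n (u : 'rV[R]_n) : (0 < n)%N ->
  measurable [set u] /\ lebesgue_rV n [set u] = 0%E.
Proof.
case: n u => // n u _.
have -> : [set u] = [set x : 'rV[R]_n.+1 | forall i, [set u 0 i] (x 0 i)].
  by apply/seteqP; split => x /= => [-> //|xu]; apply/rowP => i.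
split; last first.
  rewrite (@lebesgue_rV_box R n.+1 (fun i => [set u 0 i])) => [|i]; last first.
    exact: measurable_set1.
  by rewrite big_ord_recl/= lebesgue_measure_set1 mul0e.
rewrite (_ : mkset _ = \bigcap_(i : 'I_n.+1)
    ((fun x : 'rV[R]_n.+1 => x 0 i) @^-1` [set u 0 i])).
  apply: fin_bigcap_measurable; first exact: finite_finset.
  by move=> i _; rewrite -[X in measurable X]setTI; exact: measurable_coord.
by apply/seteqP; split => [x Ax i _|x Ax i]; [exact: Ax|exact: (Ax i)].
Qed.

End central_symmetry_invariance.

(** * Radial densities and the overlap with a translate *)

(** The density agrees almost everywhere with the Radon-Nikodym derivative,
    for which the change of variables in an integral is known. *)
Lemma integrable_density d (T : measurableType d) (R : realType)
    (nu : {finite_measure set T -> \bar R})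
    (la : {sigma_finite_measure set T -> \bar R}) (f G : T -> R) :
  measurable_fun setT f -> (forall z, 0 <= f z) ->
  (forall A, measurable A -> nu A = (\int[la]_(z in A) (f z)%:E)%E) ->
  measurable_fun setT G -> (forall z, 0 <= G z) ->
  la.-integrable setT (fun z => (G z * f z)%:E) ->
  nu.-integrable setT (EFin \o G).
Proof.
move=> mf f0 nuE mG G0 Gf.
have nula : nu `<< la.
  move=> A A0 B mB BA; rewrite nuE//; apply: null_set_integral => //.
    by apply/measurable_EFinP; exact: measurable_funTS.
  exact: A0.
have fi : la.-integrable setT (EFin \o f).
  apply/integrableP; split; first exact/measurable_EFinP.
  under eq_integral => z _ do rewrite /= ger0_norm//.
  by rewrite -nuE// -ge0_fin_numE// fin_num_measure.
have mG' : measurable_fun setT (EFin \o G) by exact/measurable_EFinP.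
apply/integrableP; split => //.
under eq_integral => z _ do rewrite /= ger0_norm//.
rewrite -(@Radon_Nikodym_SigmaFinite.change_of_variables _ _ _ _ la)//.
have fE : ae_eq la setT (Radon_Nikodym_SigmaFinite.f nu la) (EFin \o f).
  apply: integral_ae_eq => //.
  - exact: Radon_Nikodym_SigmaFinite.f_integrable.
  - exact/measurable_EFinP.
  - by move=> E _ mE; rewrite -Radon_Nikodym_SigmaFinite.f_integral// nuE.
rewrite (@ae_eq_integral _ _ _ la setT (fun z => (G z * f z)%:E))//.
- have /integrableP[_] := Gf; apply: le_lt_trans; rewrite le_eqVlt; apply/orP; left.
  by apply/eqP; apply: eq_integral => z _; rewrite /= ger0_norm// mulr_ge0.
- apply: emeasurable_funM => //; apply: measurable_int.
  exact: Radon_Nikodym_SigmaFinite.f_integrable.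
- by apply/measurable_EFinP; exact: measurable_funM.
- by apply: filterS fE => z /(_ I) fE _ /=; rewrite fE.
Qed.

Section radial.
Context {R : realType} {n : nat}.
Local Notation V := 'rV[R]_n.
Variables (mu : probability V R) (f : V -> \bar R).
Hypotheses (mf : measurable_fun setT f) (f_ge0 : forall z, (0 <= f z)%E).
Hypothesis f_anti : forall x y, enorm x <= enorm y -> (f y <= f x)%E.
Hypothesis mu_density : forall A, measurable A ->
  mu A = (\int[lebesgue_rV n]_(z in A) f z)%E.

Implicit Types (u v z : V) (A : set V).

Definition central_symmetry (u z : V) : V := u - z.

Let ms u : measurable_fun setT (central_symmetry u).
Proof. exact: measurable_central_symmetry. Qed.

Let mpre u A : measurable A -> measurable (central_symmetry u @^-1` A).
Proof. by move=> mA; rewrite -[X in measurable X]setTI; exact: ms. Qed.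

Let symK u z : central_symmetry u (central_symmetry u z) = z.
Proof. by rewrite /central_symmetry opprB addrC subrK. Qed.

(** The substitution z |-> u - z is its own inverse and preserves Lebesgue
    measure. *)
Lemma radial_central_symmetry u A : measurable A ->
  mu (central_symmetry u @^-1` A) =
  (\int[lebesgue_rV n]_(z in A) f (central_symmetry u z))%E.
Proof.
move=> mA; rewrite mu_density; last exact: mpre.
have mfs : measurable_fun setT (f \o central_symmetry u).
  exact: measurableT_comp.
transitivity (\int[image_measure (ms u) (lebesgue_rV n)]_(z in A)
    (f \o central_symmetry u) z)%E; last first.
  apply: eq_measure_integral => B mB _.
  exact: lebesgue_rV_central_symmetry.
rewrite ge0_integral_pushforward//.
- by apply: eq_integral => z _ /=; rewrite symK.
- exact: measurable_funTS.
- by move=> z _; exact: f_ge0.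
Qed.

Lemma radial_sym A : measurable A -> mu (central_symmetry 0 @^-1` A) = mu A.
Proof.
move=> mA; rewrite radial_central_symmetry// mu_density//.
apply: eq_integral => z _; rewrite /central_symmetry sub0r.
by apply/eqP; rewrite eq_le !f_anti// enormN.
Qed.

(** Since mu is symmetric, translating it by - v is the same as applying the
    point symmetry z |-> - v - z, an involution that exchanges the two sides of
    the hyperplane bounding [nearer_half v]. *)
Lemma convolution_central_symmetry v A : measurable A ->
  convolution \d_((- v)%R : V) mu A = mu (central_symmetry (- v) @^-1` A).
Proof.
move=> mA; rewrite convolution_diracE// -radial_sym; first last.
  rewrite -[X in measurable X]setTI.
  exact: measurable_translation.
by congr (mu _); apply/seteqP; split => z /=; rewrite /central_symmetry sub0r.
Qed.

(** The open half-space bounded by the bisector of 0 and - v, on the side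
    of 0; it is empty when v = 0. *)
Definition nearer_half v : set V := [set z | enorm z < enorm (z + v)].

Lemma measurable_nearer_half v : measurable (nearer_half v).
Proof.
have mlt : measurable_fun setT (fun z : V => enorm z < enorm (z + v)).
  apply: measurable_fun_ltr; first exact: measurable_enorm.
  apply: measurableT_comp; first exact: measurable_enorm.
  rewrite (_ : +%R^~ v = +%R v); first exact: measurable_translation.
  by apply/funext => z; rewrite addrC.
by rewrite /nearer_half -[X in measurable X]setTI; exact: (mlt _ [set true]).
Qed.

Local Notation H := nearer_half.
Local Notation mH := measurable_nearer_half.

Lemma convolution_le_nearer_half v A : measurable A -> A `<=` H v ->
  (convolution \d_((- v)%R : V) mu A <= mu A)%E.
Proof.
move=> mA AH; rewrite convolution_central_symmetry// radial_central_symmetry//.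
rewrite mu_density//; apply: ge0_le_integral => //.
- by apply: measurable_funTS; exact: measurableT_comp.
- exact: measurable_funTS.
- move=> z /AH/ltW zv; apply: f_anti.
  by rewrite /central_symmetry -opprD enormN addrC.
Qed.

Lemma le_convolution_nearer_halfC v A : measurable A -> A `<=` ~` H v ->
  (mu A <= convolution \d_((- v)%R : V) mu A)%E.
Proof.
move=> mA AH; rewrite convolution_central_symmetry// radial_central_symmetry//.
rewrite mu_density//; apply: ge0_le_integral => //.
- exact: measurable_funTS.
- by apply: measurable_funTS; exact: measurableT_comp.
- move=> z /AH/negP; rewrite -leNgt => zv; apply: f_anti.
  by rewrite /central_symmetry -opprD enormN addrC.
Qed.

(** The half-space is a Hahn set for mu minus its translate: on it the radial
    density of mu is the larger one, off it the smaller one. *)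
Lemma overlapE v A : measurable A -> overlap mu (- v) A =
  (mu (A `\` H v) + convolution \d_((- v)%R : V) mu (A `&` H v))%E.
Proof.
move=> mA; have [le1 le2 max12] := measure_minP mu (convolution \d_((- v)%R : V) mu).
have mHC := measurableC (mH v).
pose la : {measure set V -> \bar R} :=
  measure_add (mrestr mu mHC) (mrestr (convolution \d_((- v)%R : V) mu) (mH v)).
have laE B : la B =
    (mu (B `\` H v) + convolution \d_((- v)%R : V) mu (B `&` H v))%E.
  by rewrite setDE; exact: measure_addE.
have mD B : measurable B -> measurable (B `\` H v).
  by move=> mB; apply: measurableD => //; exact: mH.
have mI B : measurable B -> measurable (B `&` H v).
  by move=> mB; apply: measurableI => //; exact: mH.
apply/eqP; rewrite eq_le -laE; apply/andP; split.
  rewrite laE (measureDI _ mA (mH v)) leeD//.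
    by apply: le1; exact: mD.
  by apply: le2; exact: mI.
apply: max12 => // B mB; rewrite laE.
  rewrite [leRHS](measureDI _ mB (mH v)) leeD2l//.
  by apply: convolution_le_nearer_half; [exact: mI|exact: subIsetr].
rewrite [leRHS](measureDI _ mB (mH v)) leeD2r//.
by apply: le_convolution_nearer_halfC; [exact: mD|move=> z []].
Qed.

(** The part of mu that the coupling reflects. *)
Definition residual v : {finite_measure set V -> \bar R} :=
  measure_sub (overlap_le mu (- v)).

Lemma residualE v A : measurable A ->
  (residual v A + convolution \d_((- v)%R : V) mu (A `&` H v) = mu (A `&` H v))%E.
Proof.
move=> mA; have -> : residual v A = (mu A - overlap mu (- v) A)%E.
  exact: measure_subE.
rewrite overlapE//.
have mD : measurable (A `\` H v) by apply: measurableD => //; exact: mH.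
have mI : measurable (A `&` H v) by apply: measurableI => //; exact: mH.
have e B : measurable B -> mu B = (fine (mu B))%:E.
  by move=> mB; rewrite fineK// fin_num_measure.
have e' B : measurable B -> convolution \d_((- v)%R : V) mu B =
    (fine (convolution \d_((- v)%R : V) mu B))%:E.
  by move=> mB; rewrite fineK// fin_num_measure.
have -> : mu A = (mu (A `\` H v) + mu (A `&` H v))%E.
  by apply: measureDI => //; exact: mH.
rewrite (e _ mD) (e _ mI) (e' _ mI) -!EFinD.
by congr EFin => /=; ring.
Qed.

Lemma residual_nearer_halfC v : residual v (~` H v) = 0%E.
Proof.
have := residualE v (measurableC (mH v)).
by rewrite setICl !measure0 adde0.
Qed.

Lemma integral_residual v (G : V -> \bar R) : measurable_fun setT G ->
  (forall z, 0 <= G z)%E ->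
  (\int[residual v]_z G z = \int[residual v]_(z in H v) G z)%E.
Proof.
move=> mG G0; rewrite -[X in (\int[_]_(z in X) _ = _)%E](setUv (H v)).
rewrite ge0_integral_setU ?setUv//.
- rewrite [X in (_ + X)%E](_ : _ = 0%E) ?adde0//.
  apply: null_set_integral => //.
  + exact: measurableC (mH v).
  + exact: measurable_funTS.
  + exact: residual_nearer_halfC.
- exact: mH.
- exact: measurableC (mH v).
- by rewrite disj_set2E setICr.
Qed.

(** The affine function on the right measures the signed distance to the
    bisecting hyperplane, scaled by |v|. *)
Lemma nearer_halfE v z :
  (enorm z < enorm (z + v)) = (0 < dotp v z + enorm v ^+ 2 / 2).
Proof.
rewrite -(@ltr_pXn2r _ 2)// ?nnegrE ?enorm_ge0// enorm_add_sqr.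
by apply/idP/idP; lra.
Qed.

Hypothesis mu_moment : mu.-integrable setT (EFin \o @enorm R n).

Lemma integrable_dotp v : mu.-integrable setT (EFin \o dotp v).
Proof.
have mv : measurable_fun setT (EFin \o dotp v).
  by apply/measurable_EFinP; exact: measurable_dotp.
apply: (le_integrable _ mv _ (integrableZl _ (enorm v) mu_moment)) => //.
move=> z _ /=; rewrite lee_fin normrM !(ger0_norm (enorm_ge0 _)).
rewrite ler_norml cauchy_schwarz andbT lerNl -dotpNr.
by rewrite -[enorm z]enormN cauchy_schwarz.
Qed.

Lemma integral_dotp v : (\int[mu]_z (dotp v z)%:E = 0)%E.
Proof.
have iv := integrable_dotp v; rewrite integralE.
have mv : measurable_fun setT (EFin \o dotp v) by exact: measurable_int iv.
have -> : (\int[mu]_z ((fun z => (dotp v z)%:E)^\+ z) =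
    \int[mu]_z ((fun z => (dotp v z)%:E)^\- z))%E.
  transitivity (\int[image_measure (ms 0) mu]_z
      ((fun z => (dotp v z)%:E)^\+ z))%E.
    by apply: eq_measure_integral => A mA _; exact/esym/radial_sym.
  rewrite ge0_integral_pushforward//; last exact: measurable_funepos.
  apply: eq_integral => z _.
  by rewrite /= funeposE funenegE/= /central_symmetry sub0r dotpNr.
by rewrite subee// integrable_neg_fin_num.
Qed.

(** The reason why the coupling preserves the mean distance.  The point
    symmetry exchanging 0 and - v changes the sign of the affine function D
    below, so that the translate of mu contributes on the half-space the
    integral of the negative part of D.  Hence the integral of D against the
    residual is the one of D against mu, that is |v|^2 / 2 because mu is
    centred. *)
Lemma residual_moment v :
  (\int[residual v]_(z in H v) (dotp v z + enorm v ^+ 2 / 2)%:E =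
   (enorm v ^+ 2 / 2)%:E)%E.
Proof.
pose D z := dotp v z + enorm v ^+ 2 / 2.
have iD : mu.-integrable setT (EFin \o D).
  exact: (integrableD measurableT (integrable_dotp v)
    (finite_measure_integrable_cst mu (enorm v ^+ 2 / 2) measurableT)).
have mD : measurable_fun setT (EFin \o D) by exact: measurable_int iD.
have D0 z : H v z -> (0 <= (D z)%:E)%E.
  by rewrite /nearer_half/= nearer_halfE lee_fin => /ltW.
have DE : (\int[mu]_z (D z)%:E = (enorm v ^+ 2 / 2)%:E)%E.
  rewrite /D; under eq_integral do rewrite EFinD.
  rewrite integralD//; [|exact: integrable_dotp|].
    by rewrite integral_dotp add0e integral_cst//= probability_setT mule1.
  exact: (finite_measure_integrable_cst mu (enorm v ^+ 2 / 2) measurableT).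
have mHs : measurable (central_symmetry (- v) @^-1` H v).
  by apply: mpre; exact: mH.
(* The half-space is where D is positive, its symmetric where D is negative. *)
have pos : (\int[mu]_(z in H v) (D z)%:E = \int[mu]_z (EFin \o D)^\+ z)%E.
  rewrite integral_mkcond; apply: eq_integral => z _.
  rewrite patchE funeposE; case: ifPn => zH.
    by rewrite (max_idPl _)// D0// -in_setE.
  rewrite (max_idPr _)// lee_fin leNgt -nearer_halfE.
  by apply: contra zH => zH; rewrite in_setE.
have neg : (\int[convolution \d_((- v)%R : V) mu]_(z in H v) (D z)%:E =
    \int[mu]_z (EFin \o D)^\- z)%E.
  transitivity (\int[image_measure (ms (- v)) mu]_(z in H v) (D z)%:E)%E.
    apply: eq_measure_integral => A mA _.
    exact: convolution_central_symmetry.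
  rewrite ge0_integral_pushforward//.
  - rewrite integral_mkcond; apply: eq_integral => z _.
    have Ds : D (central_symmetry (- v) z) = - D z.
      rewrite /D /central_symmetry dotpDr !dotpNr -sqr_enorm; lra.
    rewrite patchE funenegE; case: ifPn => zH.
      rewrite /= Ds (max_idPl _)// lee_fin -Ds -lee_fin D0//.
      by move: zH; rewrite in_setE.
    rewrite /= (max_idPr _)// lee_fin -Ds leNgt -nearer_halfE.
    by apply: contra zH => zH; rewrite in_setE.
  - exact: mH.
  - exact: measurable_funTS.
  - by move=> z; rewrite in_setE; exact: D0.
have /esym : (\int[mu]_(z in H v) (D z)%:E =
    \int[residual v]_(z in H v) (D z)%:E +
    \int[convolution \d_((- v)%R : V) mu]_(z in H v) (D z)%:E)%E.
  rewrite -ge0_integral_measure_add//; [|exact: mH|exact: measurable_funTS].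
  apply: eq_measure_integral => A mA AH.
  have := residualE v mA; rewrite (setIidl AH) => /esym muA.
  by apply: (etrans muA); exact/esym/measure_addE.
have DI : (\int[mu]_z (D z)%:E = \int[mu]_z (EFin \o D)^\+ z -
    \int[mu]_z (EFin \o D)^\- z)%E by exact: integralE.
rewrite pos neg => XE; rewrite -DE DI -XE addeK//.
exact: integrable_neg_fin_num.
Qed.

Lemma overlap_ge v : (mu (~` H v) <= overlap mu (- v) setT)%E.
Proof. by rewrite overlapE// setTD leeDl. Qed.

End radial.

(** * A uniform lower bound on the overlap *)

(** Nothing relates m 0 to the other values of m, so m (enorm z) may fail to be
    antitone at the origin.  The origin is a null set: giving the density the
    value +oo there makes it antitone in the norm without exceptions. *)
Lemma exists_antitone_density {R : realType} {n : nat}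
    (mu : probability 'rV[R]_n R) (m : R -> R) :
  (0 < n)%N -> (forall r, 0 <= r -> 0 <= m r) ->
  measurable_fun setT (fun z : 'rV[R]_n => m (enorm z)) ->
  (forall A, measurable A ->
    mu A = (\int[lebesgue_rV n]_(z in A) (m (enorm z))%:E)%E) ->
  (forall r s : R, 0 < r -> r <= s -> m s <= m r) ->
  exists f : 'rV[R]_n -> \bar R,
    [/\ measurable_fun setT f, forall z, (0 <= f z)%E,
        forall x y, enorm x <= enorm y -> (f y <= f x)%E &
        forall A, measurable A ->
          mu A = (\int[lebesgue_rV n]_(z in A) f z)%E].
Proof.
move=> n0 m0 mm muE m_anti.
pose f (z : 'rV[R]_n) : \bar R :=
  if enorm z == 0 then +oo%E else (m (enorm z))%:E.
have mf : measurable_fun setT f.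
  apply: measurable_fun_ifT => //; last exact/measurable_EFinP.
  by apply: measurable_fun_eqr => //; exact: measurable_enorm.
have f0 z : (0 <= f z)%E by rewrite /f; case: ifP => // _; rewrite lee_fin m0 ?enorm_ge0.
exists f; split => // [x y xy|A mA].
  rewrite [leRHS]/f; case: ifPn => [_|x0]; first by rewrite leey.
  have x_gt0 : 0 < enorm x by rewrite lt_neqAle eq_sym x0 enorm_ge0.
  by rewrite /f gt_eqF ?(lt_le_trans x_gt0)// lee_fin m_anti.
have [m1 l1] := lebesgue_rV_set1 (0 : 'rV[R]_n) n0.
rewrite muE//; apply: ge0_ae_eq_integral => //.
- by apply: measurable_funTS; exact/measurable_EFinP.
- exact: measurable_funTS.
- by move=> z _; rewrite lee_fin m0// enorm_ge0.
- exists [set 0]; split => // z /= /not_implyP[Az].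
  by rewrite /f enorm_eq0; case: eqVneq.
Qed.

Section overlap_lower_bound.
Context {R : realType} {n : nat}.
Local Notation V := 'rV[R]_n.
Variables (mu : probability V R) (f : V -> \bar R).
Hypothesis n_gt0 : (0 < n)%N.
Hypotheses (mf : measurable_fun setT f) (f_ge0 : forall z, (0 <= f z)%E).
Hypothesis f_anti : forall x y, enorm x <= enorm y -> (f y <= f x)%E.
Hypothesis mu_density : forall A, measurable A ->
  mu A = (\int[lebesgue_rV n]_(z in A) f z)%E.

Let exists_pos : exists2 z, z != 0 & (0 < f z)%E.
Proof.
apply: contrapT => nz.
have [m1 l1] := lebesgue_rV_set1 (0 : V) n_gt0.
have : mu setT = 0%E.
  rewrite mu_density// (@ge0_negligible_integral _ _ _ _ _ ([set 0%R] : set V))//.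
  apply: integral0_eq => z [_ /= z0]; apply/eqP; rewrite eq_le f_ge0 andbT.
  by rewrite leNgt; apply/negP => fz; apply: nz; exists z => //; exact/eqP.
have -> : mu setT = 1%E by exact: probability_setT.
by move/eqP; rewrite onee_eq0.
Qed.

Definition box (c : V) (s : R) : set V := [set z | forall i, ball (c 0 i) s (z 0 i)].

Lemma measurable_box c s : measurable (box c s).
Proof.
rewrite (_ : box c s = \bigcap_(i : 'I_n)
    ((fun x : V => x 0 i) @^-1` ball (c 0 i) s)).
  apply: fin_bigcap_measurable; first exact: finite_finset.
  move=> i _; rewrite -[X in measurable X]setTI; apply: measurable_coord => //.
  exact: measurable_ball.
by apply/seteqP; split => [x Ax i _|x Ax i]; [exact: Ax|exact: (Ax i)].
Qed.

Lemma lebesgue_rV_cube c s : 0 <= s ->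
  lebesgue_rV n (box c s) = (\prod_(i < n) (s *+ 2)%:E)%E.
Proof.
move=> s0; rewrite (@lebesgue_rV_box R n (fun i => ball (c 0 i) s)).
  by apply: eq_bigr => i _; rewrite lebesgue_measure_ball.
by move=> i; exact: measurable_ball.
Qed.

Lemma enorm_box c s z : box c s z -> enorm (z - c) <= n%:R * s.
Proof.
move=> cz; apply: (le_trans (enorm_le_sum _)).
rewrite (_ : n%:R * s = \sum_(i < n) s); last first.
  by rewrite sumr_const card_ord mulr_natl.
by apply: ler_sum => i _; rewrite !mxE distrC ltW//; exact: cz.
Qed.

(** The overlap contains mu restricted to the half-space farther from 0 than
    from - v.  When v is short with respect to a radius r where the density is
    positive, and v is not 0, this half-space contains a cube around the point
    of norm r / 2 in the direction - v, and the mass of this cube is bounded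
    below whatever v is. *)
Lemma overlap_lower_bound : exists kappa0 : R, 0 < kappa0 /\
  exists2 e : \bar R, (0 < e)%E &
    forall v, enorm v <= kappa0 -> (e <= overlap mu (- v) setT)%E.
Proof.
have [z0 z00 fz0] := exists_pos.
have r0 : 0 < enorm z0 by rewrite enorm_gt0.
set r := enorm z0 in r0.
have nR : 0 < n%:R :> R by rewrite ltr0n.
pose s := r / 4 / n%:R.
have s0 : 0 < s by rewrite !divr_gt0.
exists (r / 2); split; first by rewrite divr_gt0.
exists (f z0 * \prod_(i < n) (s *+ 2)%:E)%E.
  rewrite mule_gt0//; apply: (big_ind (fun x : \bar R => 0 < x)%E) => //.
    by move=> x y; exact: mule_gt0.
  by move=> i _; rewrite lte_fin pmulrn_lgt0.
(* For v = 0 the inverse of the norm is 0 and the cube is centred at 0. *)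
move=> v vr; pose c : V := - (r / 2 / enorm v) *: v.
have vc : dotp v c = - (r / 2 * enorm v).
  rewrite /c dotpZr -sqr_enorm; have [->|v0] := eqVneq (enorm v) 0.
    by rewrite expr0n/= !mulr0 oppr0.
  by field.
have nc : enorm c <= r / 2.
  have r20 : 0 <= r / 2 / enorm v by rewrite !divr_ge0 ?enorm_ge0.
  rewrite /c enormZ normrN (ger0_norm r20).
  have [->|v0] := eqVneq (enorm v) 0; first by rewrite mulr0; lra.
  by rewrite divfK.
apply: le_trans (overlap_ge mf f_ge0 f_anti mu_density v).
have bc z : box c s z -> enorm (z - c) <= r / 4.
  by move/enorm_box/le_trans; apply; rewrite /s mulrC divfK ?gt_eqF.
apply: (@le_trans _ _ (mu (box c s))).
  rewrite -(lebesgue_rV_cube c (ltW s0)) mu_density; last exact: measurable_box.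
  rewrite -integral_cst; last exact: measurable_box.
  apply: ge0_le_integral => //.
  - exact: measurable_box.
  - by move=> z _; exact: f_ge0.
  - exact: measurable_funTS.
  - move=> z /bc zc; apply: f_anti; rewrite -/r.
    by rewrite -(subrK c z) (le_trans (ler_enormD _ _))//; lra.
apply: le_measure; rewrite ?inE.
- exact: measurable_box.
- exact: measurableC (measurable_nearer_half _).
- move=> z /bc zc; apply/negP; rewrite nearer_halfE -leNgt.
  rewrite -(subrK c z) dotpDr vc.
  have := cauchy_schwarz v (z - c).
  have := enorm_ge0 v; nra.
Qed.

End overlap_lower_bound.

Section overlap_inf.
Context {R : realType} {n : nat} (mu : probability 'rV[R]_n R).
Variables (kappa0 : R).
Hypothesis kappa0_gt0 : 0 < kappa0.

Lemma overlap_le1 v : (overlap mu v setT <= 1)%E.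
Proof.
apply: le_trans (overlap_le mu v measurableT) _.
by rewrite le_eqVlt; apply/orP; left; apply/eqP/probability_setT.
Qed.

Let inf := ereal_inf [set overlap mu z setT | z in [set z | enorm z <= kappa0]].

Let inf_fin : inf \is a fin_num.
Proof.
rewrite ge0_fin_numE; last by apply: le_ereal_inf_tmp => _ [z _ <-].
apply: (@le_lt_trans _ _ 1%E); last exact: ltry.
apply: (@le_trans _ _ (overlap mu 0 setT)); last exact: overlap_le1.
by apply: ereal_inf_lbound; exists 0 => //=; rewrite enorm0 ltW.
Qed.

Lemma overlap_inf_le v : enorm v <= kappa0 ->
  ((overlap_inf mu kappa0)%:E <= overlap mu (- v) setT)%E.
Proof.
move=> vk; rewrite fineK//; apply: ereal_inf_lbound.
by exists (- v) => //=; rewrite enormN.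
Qed.

Lemma overlap_inf_le1 : overlap_inf mu kappa0 <= 1.
Proof.
rewrite -lee_fin; apply: (@le_trans _ _ (overlap mu (- 0) setT)); last exact: overlap_le1.
by apply: overlap_inf_le; rewrite enorm0 ltW.
Qed.

Lemma overlap_inf_gt0 e : (0 < e)%E ->
  (forall v, enorm v <= kappa0 -> (e <= overlap mu (- v) setT)%E) ->
  0 < overlap_inf mu kappa0.
Proof.
move=> e0 le_e; rewrite -lte_fin fineK//; apply: (lt_le_trans e0).
apply: le_ereal_inf_tmp => _ [z /= zk <-].
by rewrite -(opprK z); apply: le_e; rewrite enormN.
Qed.

End overlap_inf.

(** * The concave profile of the distance *)

Section profile.
Context {R : realType}.
Implicit Types (c Rr r s t k u : R).

Definition profile c Rr t : R :=
  1 - expR (- (c * t)) + c * expR (- (c * Rr)) * t.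

Definition profile_slope c Rr t : R :=
  c * (expR (- (c * t)) + expR (- (c * Rr))).

Lemma profile0 c Rr : profile c Rr 0 = 0.
Proof. by rewrite /profile !mulr0 oppr0 expR0 subrr addr0. Qed.

Lemma profile_slope_ge0 c Rr t : 0 <= c -> 0 <= profile_slope c Rr t.
Proof. by move=> c0; rewrite mulr_ge0// addr_ge0 ?expR_ge0. Qed.

Lemma profile_tangent c Rr s t :
  profile c Rr t <= profile c Rr s + profile_slope c Rr s * (t - s).
Proof.
have := expR_ge1Dx (- (c * (t - s))).
rewrite -(ler_pM2l (expR_gt0 (- (c * s)))) -expRD.
rewrite (_ : - (c * s) + - (c * (t - s)) = - (c * t)); last by ring.
by rewrite /profile /profile_slope => ?; nra.
Qed.

Lemma profile_increment c Rr s t : 0 <= c -> s <= t ->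
  c * expR (- (c * Rr)) * (t - s) <= profile c Rr t - profile c Rr s.
Proof.
move=> c0 st.
have : expR (- (c * t)) <= expR (- (c * s)).
  by rewrite ler_expR lerN2 ler_wpM2l.
rewrite /profile; lra.
Qed.

Lemma le_profile c Rr s t : 0 <= c -> s <= t ->
  profile c Rr s <= profile c Rr t.
Proof.
move=> c0 st; rewrite -subr_ge0 (le_trans _ (profile_increment Rr c0 st))//.
by rewrite !mulr_ge0 ?expR_ge0 ?subr_ge0.
Qed.

Lemma profile_le c Rr t : 0 <= c -> 0 <= Rr -> 0 <= t ->
  profile c Rr t <= 1 + c * t.
Proof.
move=> c0 R0 t0; have e1 : expR (- (c * Rr)) <= 1.
  by rewrite -expR0 ler_expR oppr_le0 mulr_ge0.
have := expR_ge0 (- (c * t)).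
have : c * t * expR (- (c * Rr)) <= c * t * 1 by rewrite ler_wpM2l ?mulr_ge0.
rewrite /profile; lra.
Qed.

(** Used with K >= 0 an upper bound of s - r that may be far from sharp,
    for instance when the drift brings the points closer. *)
Lemma profile_growth c Rr r s K : 0 <= c -> 0 <= K -> s - r <= K ->
  profile c Rr s <= profile c Rr r + profile_slope c Rr r * K.
Proof.
move=> c0 K0 sK; apply: le_trans (profile_tangent c Rr r s) _.
by rewrite lerD2l ler_wpM2l ?profile_slope_ge0.
Qed.

(** Keeping the factor expR u, rather than 1, in the remainder makes the gain
    of [profile_second_order] comparable with the slope at s - k / 2 instead of
    the slope at s, however large c * k is. *)
Lemma expR_second_order u : 0 <= u ->
  1 + 2 * u + u ^+ 2 / 4 * expR u <= expR (2 * u).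
Proof.
move=> u0; have double t : expR t = expR (t / 2) * expR (t / 2).
  by rewrite -expRD; congr expR; field.
have u2 : 0 <= u / 2 by rewrite divr_ge0.
(* A quadratic lower bound, from squaring 1 + u / 2 <= expR (u / 2). *)
have uE : 1 + u + u ^+ 2 / 4 <= expR u.
  have h : 1 + u / 2 <= expR (u / 2) by exact: expR_ge1Dx.
  rewrite [leRHS]double (_ : _ + _ = (1 + u / 2) * (1 + u / 2)); last by field.
  by apply: ler_pM => //; lra.
rewrite [leRHS]double (_ : 2 * u / 2 = u); last by field.
set E := expR u in uE *; have u20 : 0 <= u ^+ 2 by exact: sqr_ge0.
have w0 : 0 <= u ^+ 2 / 4 by rewrite divr_ge0.
set w := u ^+ 2 / 4 in uE w0 *.
have : (1 + u) * (1 + u) <= E * (E - w) by apply: ler_pM; lra.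
lra.
Qed.

(** Strict concavity: going down from s by k along the profile loses more than
    the tangent predicts, by an amount measured at the midpoint s - k / 2.  Where
    this is used with k = kappa and s = rh > kappa, the starting distance r is
    to the right of that midpoint. *)
Lemma profile_second_order c Rr s k : 0 <= c -> 0 <= k ->
  profile c Rr (s - k) + k * profile_slope c Rr s <=
  profile c Rr s - (c * k) ^+ 2 / 16 * expR (- (c * (s - k / 2))).
Proof.
move=> c0 k0; have ck : 0 <= c * k / 2 by rewrite !mulr_ge0.
have := expR_second_order ck.
rewrite -(ler_pM2l (expR_gt0 (- (c * s)))) -expRD.
rewrite (_ : - (c * s) + 2 * (c * k / 2) = - (c * (s - k))); last by field.
have : expR (- (c * s)) * expR (c * k / 2) = expR (- (c * (s - k / 2))).
  by rewrite -expRD; congr expR; field.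
rewrite /profile /profile_slope.
set A := expR (- (c * s)); set B := expR (c * k / 2).
move=> <-; set C := expR (- (c * (s - k))); set D := expR _.
move=> h; have : A * (1 + 2 * (c * k / 2) + (c * k / 2) ^+ 2 / 4 * B) =
  A + c * k * A + (c * k) ^+ 2 / 16 * (A * B) by field.
move: h => /[swap] -> h; nra.
Qed.

(** The equations for c and a are those of the theorem with eta = h L and
    kappa = g h * kappa0; the bound on eta * Rr keeps rh - kappa / 2 to the left
    of r as long as r < Rr. *)
Lemma contraction_rate (c a Rr J kappa eta lam : R) :
  0 < J <= 1 -> 0 < kappa -> 0 <= Rr -> 0 <= eta < 1 -> lam < 1 ->
  eta * Rr <= kappa / 2 -> 0 < c ->
  c * (J * kappa ^+ 2) = 32 * eta * Rr + J * kappa ^+ 2 ->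
  1 <= a -> a * J = 2 * c * (1 + expR (- (c * Rr))) * eta * kappa + J ->
  exists cstar : R, 0 < cstar < 1 /\ forall r rh p s, 0 < r ->
    (1 - eta) * r <= rh -> rh <= (1 + eta) * r -> (Rr <= r -> rh <= lam * r) ->
    J <= p <= 1 -> s = Num.min rh kappa ->
    p * (a * (s < rh)%R%:R + profile c Rr (rh - s) + s * profile_slope c Rr rh) +
      (1 - p) * (a + profile c Rr rh) <= (1 - cstar) * (a + profile c Rr r).
Proof.
move=> /andP[J0 J1] k0 R0 /andP[eta0 eta1] lam1 etaR c0 cE a1 aE.
set E := expR (- (c * Rr)) in aE *.
have E0 : 0 < E by exact: expR_gt0.
have c_ge0 := ltW c0; have k_ge0 := ltW k0.
have J_ge0 := ltW J0; have E_ge0 := ltW E0.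
have eta1_ge0 : 0 <= 1 - eta by lra.
pose B1 := a + 1 + c * (kappa / (1 - eta)).
pose B2 := a + 1 + c * Rr.
pose B3 := (a + 1) / kappa + c.
pose D2 := c * E * J * kappa ^+ 2 / 16.
pose D3 := c * E * (1 - lam).
have B10 : 0 < B1.
  have : 0 <= c * (kappa / (1 - eta)) by rewrite !mulr_ge0 ?invr_ge0.
  rewrite /B1; lra.
have B20 : 0 < B2.
  have : 0 <= c * Rr by rewrite mulr_ge0.
  rewrite /B2; lra.
have B30 : 0 < B3 by rewrite addr_gt0// divr_gt0//; lra.
have D20 : 0 < D2 by rewrite !mulr_gt0 ?invr_gt0 ?exprn_gt0.
have D30 : 0 < D3 by rewrite !mulr_gt0// subr_gt0.
pose cs := Num.min 2^-1 (Num.min (J / B1) (Num.min (D2 / B2) (D3 / B3))).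
have cs0 : 0 < cs.
  by rewrite !lt_min (divr_gt0 J0 B10) (divr_gt0 D20 B20) (divr_gt0 D30 B30)
    invr_gt0 ltr0n.
have cs1 : cs <= 2^-1 by rewrite ge_min lexx.
have csB1 : cs * B1 <= J by rewrite -ler_pdivlMr// !ge_min lexx !orbT.
have csB2 : cs * B2 <= D2 by rewrite -ler_pdivlMr// !ge_min lexx !orbT.
have csB3 : cs * B3 <= D3 by rewrite -ler_pdivlMr// !ge_min lexx !orbT.
exists cs; split; first by rewrite cs0 /=; lra.
move=> r rh p s r0 rh_ge rh_le rh_lam /andP[Jp p1] sE.
set f := profile c Rr; have r_ge0 := ltW r0.
have fr : f r <= 1 + c * r by apply: profile_le => //; exact: ltW.
have rh0 : 0 <= rh by rewrite (le_trans _ rh_ge)// mulr_ge0.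
(* In each regime, D is the gain and B a bound on the value at r; the three
   quotients D / B and 1 / 2 are the numbers of which cs is the minimum. *)
suff [D [B [gain fB csB]]] : exists D B,
    [/\ p * (a * (s < rh)%R%:R + f (rh - s) + s * profile_slope c Rr rh) +
      (1 - p) * (a + f rh) <= a + f r - D, a + f r <= B & cs * B <= D].
  have : cs * (a + f r) <= cs * B by apply: ler_wpM2l => //; exact: ltW.
  lra.
(* The points meet with probability p. *)
have [rhk|krh] := leP rh kappa.
  rewrite sE (min_idPl rhk) ltxx subrr mulr0 add0r.
  have := profile_second_order Rr rh c_ge0 rh0.
  rewrite subrr -/f.
  have : 0 <= (c * rh) ^+ 2 / 16 * expR (- (c * (rh - rh / 2))).
    by rewrite !mulr_ge0 ?sqr_ge0 ?expR_ge0.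
  move=> g0 g1.
  have {g0 g1} g : f 0 + rh * profile_slope c Rr rh <= f rh by lra.
  have ff : f rh <= f r + (a * J - J).
    rewrite aE addrK; have [rhr|rrh] := leP rh r.
      rewrite (le_trans (le_profile Rr c_ge0 rhr))// lerDl.
      by rewrite !mulr_ge0 ?addr_ge0 ?expR_ge0.
    have h : rh - r <= eta * kappa.
      have : eta * r <= eta * kappa by rewrite ler_wpM2l//; lra.
      lra.
    have ek : 0 <= eta * kappa by rewrite mulr_ge0// ltW.
    apply: le_trans (profile_growth Rr c_ge0 ek h) _.
    rewrite lerD2l /profile_slope -/E.
    have e1 : expR (- (c * r)) <= 1.
      by rewrite -expR0 ler_expR oppr_le0 mulr_ge0.
    have : c * (eta * kappa) * (expR (- (c * r)) + E) <= c * (eta * kappa) * (1 + E).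
      by rewrite ler_wpM2l ?mulr_ge0// ?lerD2r.
    have : 0 <= c * (eta * kappa) * (1 + E) by rewrite !mulr_ge0 ?addr_ge0.
    lra.
  exists J, B1; split => //.
    have : p * (f 0 + rh * profile_slope c Rr rh) <= p * f rh.
      by rewrite ler_wpM2l//; lra.
    have : J * a <= p * a by rewrite ler_wpM2r//; lra.
    lra.
  have : c * r <= c * (kappa / (1 - eta)).
    rewrite ler_wpM2l// ler_pdivlMr ?subr_gt0//; lra.
  rewrite /B1; lra.
rewrite sE (min_idPr (ltW krh)) krh mulr1.
have g2 := profile_second_order Rr rh c_ge0 (ltW k0).
set G := (c * kappa) ^+ 2 / 16 * _ in g2.
have G0 : 0 <= G by rewrite !mulr_ge0 ?sqr_ge0 ?expR_ge0.
have main : p * (a + f (rh - kappa) + kappa * profile_slope c Rr rh) +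
    (1 - p) * (a + f rh) <= a + f rh - J * G.
  have : p * (f (rh - kappa) + kappa * profile_slope c Rr rh) <= p * (f rh - G).
    by rewrite ler_wpM2l//; lra.
  have : J * G <= p * G by rewrite ler_wpM2r.
  lra.
(* Dissipative regime: since lam < 1, r exceeds kappa. *)
have [Rler|rltR] := leP Rr r.
  exists (D3 * r), (B3 * r); split.
  - apply: (le_trans main).
    have JG : 0 <= J * G by rewrite mulr_ge0.
    have lr := rh_lam Rler.
    have lamr : lam * r <= r by rewrite ger_pMl ?ltW.
    have := profile_increment Rr c_ge0 lamr.
    have := le_profile Rr c_ge0 lr.
    rewrite -/f -/E /D3; lra.
  - have kr : kappa <= r.
      have : lam * r <= r by rewrite ger_pMl ?ltW.
      have := rh_lam Rler; lra.
    have : a + 1 <= (a + 1) / kappa * r.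
      by rewrite mulrAC ler_pdivlMr// ler_pM2l//; lra.
    rewrite /B3; lra.
  - by rewrite mulrA ler_pM2r.
(* The gain from concavity exceeds the growth due to the drift by D2. *)
exists D2, B2; split => //; last first.
  have : c * r <= c * Rr by rewrite ler_wpM2l// ltW.
  rewrite /B2; lra.
apply: (le_trans main).
have er : eta * r <= eta * Rr by rewrite ler_wpM2l// ltW.
have Er : E <= expR (- (c * r)) by rewrite ler_expR lerN2 ler_wpM2l// ltW.
have Gr : (c * kappa) ^+ 2 / 16 * expR (- (c * r)) <= G.
  rewrite ler_wpM2l ?mulr_ge0 ?sqr_ge0// ler_expR lerN2 ler_wpM2l//; lra.
have eR0 : 0 <= eta * Rr by rewrite mulr_ge0.
have dr : rh - r <= eta * Rr by lra.
have := profile_growth Rr c_ge0 eR0 dr; rewrite -/f /profile_slope -/E => g1.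
set Q := expR (- (c * r)) in Er Gr g1 *.
have JGr : J * ((c * kappa) ^+ 2 / 16 * Q) <= J * G by rewrite ler_wpM2l.
have e1 : J * ((c * kappa) ^+ 2 / 16 * Q) =
    2 * (c * Q * (eta * Rr)) + c * J * kappa ^+ 2 / 16 * Q.
  rewrite (_ : J * _ = c * (J * kappa ^+ 2) * (c * Q / 16)); last by field.
  by rewrite cE; field.
have e2 : c * (Q + E) * (eta * Rr) <= 2 * (c * Q * (eta * Rr)).
  have : c * (eta * Rr) * E <= c * (eta * Rr) * Q.
    by rewrite ler_wpM2l// mulr_ge0.
  lra.
have e3 : D2 <= c * J * kappa ^+ 2 / 16 * Q.
  rewrite /D2 (_ : c * E * J * kappa ^+ 2 / 16 = c * J * kappa ^+ 2 / 16 * E).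
    by rewrite ler_wpM2l// !mulr_ge0 ?sqr_ge0.
  by field.
lra.
Qed.

End profile.

(** * The expected distance after one step *)

Section rho.
Context {R : realType} {n : nat}.
Local Notation V := 'rV[R]_n.
Variables a c Rr : R.

Lemma rhoE (x y : V) : rho a c Rr x y =
  a * (0 < enorm (x - y))%R%:R + profile c Rr (enorm (x - y)).
Proof. by rewrite /rho /profile !addrA. Qed.

Lemma rho_refl (x : V) : rho a c Rr x x = 0.
Proof. by rewrite rhoE subrr enorm0 ltxx mulr0 profile0 addr0. Qed.

Hypotheses (a_ge0 : 0 <= a) (c_ge0 : 0 <= c).

Lemma profile_ge0 r : 0 <= r -> 0 <= profile c Rr r.
Proof. by move=> r0; rewrite -(profile0 c Rr) le_profile. Qed.

Lemma rho_ge0 (x y : V) : 0 <= rho a c Rr x y.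
Proof. by rewrite rhoE addr_ge0 ?mulr_ge0 ?profile_ge0 ?enorm_ge0. Qed.

Lemma measurable_rho :
  measurable_fun setT (fun p : V * V => rho a c Rr p.1 p.2).
Proof.
pose r (p : V * V) := enorm (p.1 - p.2).
have mr : measurable_fun setT r.
  apply: measurableT_comp; first exact: measurable_enorm.
  apply: measurable_fun_rVP => i.
  apply: (eq_measurable_fun (fun p : V * V => p.1 0 i - p.2 0 i)).
    by move=> p _; rewrite !mxE.
  by apply: measurable_funB; apply: (measurableT_comp (measurable_coord i));
    [exact: measurable_fst|exact: measurable_snd].
apply: (eq_measurable_fun (fun p => a * (if 0 < r p then 1 else 0) +
    ((1 - expR (- (c * r p))) + c * expR (- (c * Rr)) * r p))).
  by move=> p _; rewrite rhoE /r; case: ifP.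
apply: measurable_funD.
  apply: measurable_funM => //.
  by apply: measurable_fun_ifT => //; exact: measurable_fun_ltr.
apply: measurable_funD; last exact: measurable_funM.
apply: measurable_funB => //; apply: measurableT_comp => //.
by apply: measurableT_comp => //; exact: measurable_funM.
Qed.

End rho.

Section coupling_estimate.
Context {R : realType} {n : nat}.
Local Notation V := 'rV[R]_n.
Variables (mu : probability V R) (f : V -> \bar R).
Hypotheses (mf : measurable_fun setT f) (f_ge0 : forall z, (0 <= f z)%E).
Hypothesis f_anti : forall x y, enorm x <= enorm y -> (f y <= f x)%E.
Hypothesis mu_density : forall A, measurable A ->
  mu A = (\int[lebesgue_rV n]_(z in A) f z)%E.
Hypothesis mu_moment : mu.-integrable setT (EFin \o @enorm R n).

Variables (b : V -> V) (g : R -> R) (h kappa : R) (a c Rr : R).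
Hypotheses (gh_gt0 : 0 < g h) (kappa_gt0 : 0 < kappa).
Hypotheses (a_ge0 : 0 <= a) (c_ge0 : 0 <= c).

Let EFin_rho : V * V -> \bar R := fun p => (rho a c Rr p.1 p.2)%:E.

Let m_rho : measurable_fun setT EFin_rho.
Proof. by apply/measurable_EFinP; exact: measurable_rho. Qed.

Let rho0 p : (0 <= EFin_rho p)%E.
Proof. by rewrite lee_fin rho_ge0. Qed.

Lemma expectation_coupling_diag x :
  ('E_(coupling b g h kappa mu x x) [fun p => rho a c Rr p.1 p.2] = 0)%E.
Proof.
rewrite unlock ge0_integral_coupling// -/EFin_rho !integral0_eq ?adde0//.
- by move=> z _; rewrite /= /reflection eqxx rho_refl.
- move=> z _; rewrite /= /coupling_shift /truncate subrr !scaler0 addr0.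
  by rewrite rho_refl.
Qed.

Section off_diagonal.
Variables x y : V.
Let u := drift_step b h x - drift_step b h y.
Let rh := enorm u.
Let s := Num.min rh kappa.
Let v := coupling_shift b g h kappa x y.
Hypothesis u0 : u != 0.

Let rh0 : 0 < rh. Proof. by rewrite enorm_gt0. Qed.

Let s0 : 0 < s. Proof. by rewrite lt_min rh0. Qed.

Let truncE : truncate kappa u = (s / rh) *: u.
Proof.
rewrite /truncate; congr (_ *: _).
have [rk|kr] := leP rh kappa.
  rewrite /s (min_idPl rk) divff ?gt_eqF//; apply/min_idPl.
  by rewrite ler_pdivlMr ?mul1r.
rewrite /s (min_idPr (ltW kr)); apply/min_idPr.
by rewrite ler_pdivrMr// mul1r ltW.
Qed.

Let vE : v = (s / (g h * rh)) *: u.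
Proof.
rewrite /v /coupling_shift truncE scalerA; congr (_ *: _).
by field; rewrite !gt_eqF.
Qed.

Let norm_v : enorm v = s / g h.
Proof.
rewrite vE enormZ ger0_norm; last by rewrite divr_ge0 ?mulr_ge0 ?ltW.
by rewrite -/rh; field; rewrite !gt_eqF.
Qed.

Lemma enorm_coupling_shift_le : enorm v <= kappa / g h.
Proof. by rewrite norm_v ler_pM2r ?invr_gt0// ge_min lexx orbT. Qed.

Lemma dist_coupling_sync z :
  enorm ((coupling_sync b g h kappa x y z).1 -
    (coupling_sync b g h kappa x y z).2) = rh - s.
Proof.
rewrite /coupling_sync/= -/v.
have -> : drift_step b h x + g h *: z -
    (drift_step b h y + g h *: (z + v)) = u - g h *: v.
  rewrite scalerDr opprD addrACA -/u; congr (_ + _).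
  by rewrite opprD addrA subrr sub0r.
rewrite vE scalerA -[u in u - _]scale1r -scalerBl enormZ -/rh.
have srh : s <= rh by rewrite ge_min lexx.
rewrite (_ : 1 - _ = (rh - s) / rh); last by field; rewrite !gt_eqF.
have q0 : 0 <= (rh - s) / rh by rewrite divr_ge0 ?subr_ge0// (ltW rh0).
by rewrite (ger0_norm q0) divfK ?gt_eqF.
Qed.

(** X - Y stays on the line of u, and on the half-space it does not change
    direction, so the distance is an affine function of z. *)
Lemma dist_coupling_refl z : nearer_half v z ->
  enorm ((coupling_refl b g h x y z).1 - (coupling_refl b g h x y z).2) =
  rh - s + 2 * g h ^+ 2 / s * (dotp v z + enorm v ^+ 2 / 2).
Proof.
rewrite /nearer_half/= nearer_halfE => Dz.
rewrite /coupling_refl/= /reflection -subr_eq0 -/u (negPf u0).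
set k := 2 * dotp u z / _.
have -> : drift_step b h x + g h *: z -
    (drift_step b h y + g h *: (z - k *: u)) = (1 + g h * k) *: u.
  rewrite scalerBr opprD addrACA -/u opprB [X in u + X]addrC subrK.
  by rewrite scalerA scalerDl scale1r.
have srh : s <= rh by rewrite ge_min lexx.
have kE : (1 + g h * k) * rh =
    rh - s + 2 * g h ^+ 2 / s * (dotp v z + enorm v ^+ 2 / 2).
  rewrite norm_v {1}vE dotpZl /k -/rh; field.
  by rewrite !gt_eqF.
rewrite enormZ -/rh -kE -[in LHS](ger0_norm (ltW rh0)) -normrM ger0_norm//.
rewrite kE addr_ge0 ?subr_ge0// mulr_ge0 ?(ltW Dz)//.
by rewrite divr_ge0 ?mulr_ge0 ?exprn_ge0// ltW.
Qed.

(** The tangent of the profile at rh bounds the reflected part from above by an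
    affine function of z, which [residual_moment] integrates exactly. *)
Lemma expectation_coupling_le (p := fine (overlap mu (- v) setT)) :
  ('E_(coupling b g h kappa mu x y) [fun q => rho a c Rr q.1 q.2] <=
   (p * (a * (s < rh)%R%:R + profile c Rr (rh - s) +
      s * profile_slope c Rr rh) +
    (1 - p) * (a + profile c Rr rh))%:E)%E.
Proof.
have pE : overlap mu (- v) setT = p%:E by rewrite fineK// fin_num_measure.
set sl := profile_slope c Rr rh.
have sl0 : 0 <= sl by exact: profile_slope_ge0.
have srh : s <= rh by rewrite ge_min lexx.
pose D z := dotp v z + enorm v ^+ 2 / 2.
pose A := a + profile c Rr rh - sl * s; pose B := sl * (2 * g h ^+ 2 / s).
have A0 : 0 <= A.
  have := profile_tangent c Rr rh (rh - s).
  rewrite -/sl (_ : rh - s - rh = - s); last by ring.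
  rewrite mulrN => /(le_trans (profile_ge0 _ c_ge0 _)) pr.
  by rewrite /A -addrA addr_ge0// pr// subr_ge0.
have B0 : 0 <= B by rewrite !(mulr_ge0, invr_ge0, exprn_ge0)// ltW.
have mH := measurable_nearer_half v.
have D0 z : nearer_half v z -> 0 <= D z.
  by rewrite /nearer_half/= nearer_halfE => /ltW.
have mD : measurable_fun setT (EFin \o D).
  by apply/measurable_EFinP; apply: measurable_funD => //; exact: measurable_dotp.
rewrite unlock ge0_integral_coupling// -/EFin_rho -/v.
have -> : (\int[overlap mu (- v)]_z EFin_rho (coupling_sync b g h kappa x y z) =
    (p * (a * (s < rh)%R%:R + profile c Rr (rh - s)))%:E)%E.
  under eq_integral => z _.
    rewrite /EFin_rho rhoE dist_coupling_sync subr_gt0; over.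
  by rewrite integral_cst// [X in (_ * X)%E]pE muleC.
rewrite -/(residual mu v).
have -> : p * (a * (s < rh)%R%:R + profile c Rr (rh - s) + s * sl) +
      (1 - p) * (a + profile c Rr rh) =
    p * (a * (s < rh)%R%:R + profile c Rr (rh - s)) +
    (A * (1 - p) + B * (enorm v ^+ 2 / 2)).
  by rewrite norm_v /A /B; field; rewrite !gt_eqF.
rewrite EFinD leeD2l//.
have mrefl : measurable_fun setT
    (fun z => EFin_rho (coupling_refl b g h x y z)).
  by apply: measurableT_comp => //; exact: measurable_coupling_refl.
rewrite (integral_residual mf f_ge0 f_anti mu_density)//; last first.
  by move=> z; exact: rho0.
apply: (@le_trans _ _
    (\int[residual mu v]_(z in nearer_half v) (A%:E + B%:E * (D z)%:E))%E).
  apply: ge0_le_integral => //.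
  - by move=> z _; exact: rho0.
  - exact: measurable_funTS.
  - apply: measurable_funTS; apply: emeasurable_funD => //.
    exact: emeasurable_funM.
  - move=> z Hz; rewrite /EFin_rho rhoE dist_coupling_refl// -/(D z).
    rewrite -EFinM -EFinD lee_fin.
    set t := rh - s + _.
    have := profile_tangent c Rr rh t; rewrite -/sl.
    have : a * (0 < t)%R%:R <= a by rewrite ler_piMr// lern1 leq_b1.
    have -> : A + B * D z = a + (profile c Rr rh + sl * (t - rh)).
      by rewrite /A /B /t; ring.
    lra.
rewrite ge0_integralD//; first last.
- by apply: measurable_funTS; exact: emeasurable_funM.
- by move=> z /D0 Dz; rewrite mule_ge0 ?lee_fin.
rewrite ge0_integralZl//; first last.
- exact: measurable_funTS.
rewrite [leRHS]EFinD leeD//.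
  rewrite integral_cst// EFinM lee_wpmul2l ?lee_fin//.
  apply: (@le_trans _ _ (residual mu v setT)).
    by apply: le_measure => //; rewrite inE.
  have -> : residual mu v setT = (mu setT - overlap mu (- v) setT)%E.
    exact: measure_subE.
  by rewrite pE; have -> : mu setT = 1%E by exact: probability_setT.
by rewrite (residual_moment mf f_ge0 f_anti mu_density mu_moment) -EFinM.
Qed.

End off_diagonal.
End coupling_estimate.

(** * The drift step and the contraction *)

Section drift.
Context {R : realType} {n : nat}.
Variables (b : 'rV[R]_n -> 'rV[R]_n) (h L : R) (x y : 'rV[R]_n).
Hypothesis h_ge0 : 0 <= h.
Hypothesis b_lip : enorm (b x - b y) <= L * enorm (x - y).

Lemma drift_stepB : drift_step b h x - drift_step b h y =
  x - y + h *: (b x - b y).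
Proof. by rewrite /drift_step opprD addrACA -scalerBr. Qed.

Let hb : enorm (h *: (b x - b y)) <= h * L * enorm (x - y).
Proof. by rewrite enormZ ger0_norm// -mulrA ler_wpM2l. Qed.

Lemma drift_step_le : enorm (drift_step b h x - drift_step b h y) <=
  (1 + h * L) * enorm (x - y).
Proof. by rewrite drift_stepB (le_trans (ler_enormD _ _))//; have := hb; lra. Qed.

Lemma drift_step_ge : (1 - h * L) * enorm (x - y) <=
  enorm (drift_step b h x - drift_step b h y).
Proof.
have := hb; rewrite drift_stepB; set w := h *: _.
have := ler_enormD (x - y + w) (- w); rewrite addrK enormN; lra.
Qed.

(** The square root vanishes on negative numbers, so the bound is meaningful
    whatever the sign of its argument. *)
Lemma drift_step_contract K :
  dotp (x - y) (b x - b y) <= - K * enorm (x - y) ^+ 2 ->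
  enorm (drift_step b h x - drift_step b h y) <=
  Num.sqrt (1 - 2 * h * K + h ^+ 2 * L ^+ 2) * enorm (x - y).
Proof.
move=> bK; have L2 : enorm (b x - b y) ^+ 2 <= L ^+ 2 * enorm (x - y) ^+ 2.
  have e0 := enorm_ge0 (b x - b y).
  by rewrite -exprMn lerXn2r// nnegrE ?(le_trans e0 b_lip).
have sq : enorm (drift_step b h x - drift_step b h y) ^+ 2 <=
    (1 - 2 * h * K + h ^+ 2 * L ^+ 2) * enorm (x - y) ^+ 2.
  rewrite drift_stepB enorm_add_sqr dotpC dotpZr enormZ exprMn.
  rewrite real_normK ?num_real//.
  have := ler_wpM2l h_ge0 bK; have := ler_wpM2l (sqr_ge0 h) L2; lra.
rewrite -[leLHS]ger0_norm ?enorm_ge0// -sqrtr_sqr.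
rewrite -[enorm (x - y)]ger0_norm ?enorm_ge0// -sqrtr_sqr mulrC.
by rewrite -sqrtrM ?sqr_ge0// mulrC ler_wsqrtr.
Qed.

End drift.

Theorem theorem3p8 (R : realType) (d : nat) (b : 'rV[R]_d -> 'rV[R]_d)
    (g : R -> R) (mu : probability 'rV[R]_d R) (L K Rr : R) (m : R -> R)
    (d_gt0 : (0 < d)%N)
    (g_cont : {within `[0, +oo[, continuous g})
    (g_incr : forall s t : R, 0 <= s -> s < t -> g s < g t)
    (g0 : g 0 = 0)
    (L_ge0 : 0 <= L)
    (c1 : forall x y, enorm (b x - b y) <= L * enorm (x - y))
    (K_gt0 : 0 < K) (Rr_ge0 : 0 <= Rr)
    (c2 : forall x y, Rr <= enorm (x - y) ->
      dotp (x - y) (b x - b y) <= - K * enorm (x - y) ^+ 2)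
    (m_ge0 : forall r, 0 <= r -> 0 <= m r)
    (m_meas : measurable_fun setT (fun z : 'rV[R]_d => m (enorm z)))
    (m_density : forall A, measurable A ->
      mu A = (\int[lebesgue_rV d]_(z in A) (m (enorm z))%:E)%E)
    (m_noninc : forall r s : R, 0 < r -> r <= s -> m s <= m r)
    (m_moment : (lebesgue_rV d).-integrable setT
      (fun z => (enorm z * m (enorm z))%:E))
    (h_over_g : h / g h @[h --> 0^'+] --> 0) :
  exists kappa0 : R, 0 < kappa0 /\ 0 < overlap_inf mu kappa0 /\
    forall h : R, 0 < h -> h < Num.min (2 * K / L ^+ 2) L^-1 ->
      (Rr = 0 \/ h / g h <= kappa0 / (2 * L * Rr)) ->
      let J := overlap_inf mu kappa0 in
      let c := 32 * h * L * Rr / (g h ^+ 2 * kappa0 ^+ 2 * J) + 1 in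
      let a := 2 * c * (1 + expR (- (c * Rr))) * h * g h * kappa0 * L / J + 1 in
      exists cstar : R, 0 < cstar < 1 /\
        forall x y : 'rV[R]_d,
          ('E_(coupling b g h (g h * kappa0) mu x y)
              [fun p => rho a c Rr p.1 p.2] <=
            ((1 - cstar) * rho a c Rr x y)%:E)%E.
Proof.
have [f [mf f_ge0 f_anti f_density]] :=
  exists_antitone_density d_gt0 m_ge0 m_meas m_density m_noninc.
have mu_moment : mu.-integrable setT (EFin \o @enorm R d).
  apply: (integrable_density m_meas _ m_density _ _ m_moment).
  - by move=> z; rewrite m_ge0// enorm_ge0.
  - exact: measurable_enorm.
  - exact: enorm_ge0.
have [kappa0 [k0 [e e0 eJ]]] :=
  overlap_lower_bound d_gt0 mf f_ge0 f_anti f_density.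
have J0 := overlap_inf_gt0 k0 e0 eJ; have J1 := overlap_inf_le1 mu k0.
exists kappa0; do 2 split => //; move=> h h0 h_small h_Rr J c a.
rewrite -/J in J0 J1.
have gh : 0 < g h by rewrite -g0; exact: g_incr.
have k_gt0 : 0 < g h * kappa0 by rewrite mulr_gt0.
have /andP[hK hL] : (h < 2 * K / L ^+ 2) && (h < L^-1) by rewrite -lt_min.
have L0 : 0 < L by rewrite -invr_gt0 (lt_trans h0).
have hL1 : h * L < 1 by rewrite -ltr_pdivlMr// div1r.
have hL0 : 0 <= h * L by rewrite mulr_ge0// ltW.
pose lam := Num.sqrt (1 - 2 * h * K + h ^+ 2 * L ^+ 2).
have lam1 : lam < 1.
  rewrite -sqrtr1 ltr_sqrt// -subr_gt0.
  have : h * (h * L ^+ 2) < h * (2 * K).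
    by rewrite ltr_pM2l// -ltr_pdivlMr// exprn_gt0.
  lra.
have etaR : h * L * Rr <= g h * kappa0 / 2.
  have k2 : 0 <= g h * kappa0 / 2 by rewrite divr_ge0// ltW.
  case: h_Rr => [->|h_Rr]; first by rewrite mulr0.
  have [->|R0] := eqVneq Rr 0; first by rewrite mulr0.
  have Rr0 : 0 < Rr by rewrite lt_neqAle eq_sym R0.
  move: h_Rr; rewrite ler_pdivlMr ?mulr_gt0// mulrAC ler_pdivrMr//; lra.
have c_gt0 : 0 < c.
  have den : 0 < g h ^+ 2 * kappa0 ^+ 2 * J by rewrite !mulr_gt0 ?exprn_gt0.
  by rewrite ltr_wpDl// divr_ge0 ?(ltW den)// !mulr_ge0// ltW.
have cE : c * (J * (g h * kappa0) ^+ 2) =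
    32 * (h * L) * Rr + J * (g h * kappa0) ^+ 2.
  by rewrite /c; field; rewrite !gt_eqF.
clearbody c; have c_ge0 := ltW c_gt0.
have a1 : 1 <= a.
  have E0 : 0 <= 1 + expR (- (c * Rr)) by rewrite addr_ge0 ?expR_ge0.
  by rewrite lerDr divr_ge0 ?(ltW J0)// !mulr_ge0// ltW.
have aE : a * J = 2 * c * (1 + expR (- (c * Rr))) * (h * L) * (g h * kappa0) + J.
  by rewrite /a; field; rewrite gt_eqF.
clearbody a.
have [cstar [cstar01 rate]] := contraction_rate (introT andP (conj J0 J1)) k_gt0
  Rr_ge0 (introT andP (conj hL0 hL1)) lam1 etaR c_gt0 cE a1 aE.
exists cstar; split => // x y.
have a_ge0 : 0 <= a by rewrite (le_trans _ a1).
have [->|xy] := eqVneq x y.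
  by rewrite expectation_coupling_diag// rho_refl mulr0.
have r0 : 0 < enorm (x - y) by rewrite enorm_gt0 subr_eq0.
have rh_ge := drift_step_ge (ltW h0) (c1 x y).
have u0 : drift_step b h x - drift_step b h y != 0.
  by rewrite -enorm_gt0 (lt_le_trans _ rh_ge)// mulr_gt0// subr_gt0.
apply: (le_trans (expectation_coupling_le mf f_ge0 f_anti f_density mu_moment
  Rr gh k_gt0 a_ge0 c_ge0 u0)).
rewrite lee_fin rhoE r0 mulr1; apply: rate => //.
- exact: drift_step_le (ltW h0) (c1 x y).
- by move=> /c2; exact: drift_step_contract (ltW h0) (c1 x y) _.
- have vk := enorm_coupling_shift_le gh k_gt0 u0.
  rewrite mulrAC divff ?mul1r ?gt_eqF// in vk.
  set v := coupling_shift _ _ _ _ _ _ in vk *.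
  have pE : ((fine (overlap mu (- v) setT))%:E = overlap mu (- v) setT)%E.
    by rewrite fineK// fin_num_measure.
  by rewrite -!lee_fin pE overlap_inf_le// overlap_le1.
Qed.
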